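(* Let a tetrahedron with vertices $v_1,v_2,v_3,v_4$ be given in any one of the three geometries $\mathbf{S}^3$, $\mathbf{H}^3$, $\mathbf{E}^3$. Let $x_{ij}=x_{ji}$ be the length of the edge $v_iv_j$ and let $a_{ij}=a_{ji}$ be the dihedral angle at the edge $v_iv_j$. Consider each $a_{ij}$ as a function of the six edge lengths $x_{12},x_{13},x_{14},x_{23},x_{24},x_{34}$, and for any two edges $\{i,j\}$ and $\{r,s\}$ define $$P^{ij}_{rs}=\frac{1}{\sin(a_{ij})\,\sin(a_{rs})}\,\frac{\partial a_{ij}}{\partial x_{rs}}.$$ Then the following identities hold, where the indices $i,j,k,l$ are pairwise distinct, i.e. $\{i,j,k,l\}=\{1,2,3,4\}$: (i) $P^{ij}_{rs}=P^{rs}_{ij}$ for all edges $\{i,j\}$, $\{r,s\}$. (ii) $P^{ij}_{kl}=P^{ik}_{jl}=P^{il}_{jk}$. (iii) $P^{ij}_{ik}=-P^{ij}_{kl}\cos(a_{jk})$. (iv) $P^{ij}_{ij}=P^{ij}_{kl}\,w_{ij}$, where $$w_{ij}=\frac{c_{ij}c_{jk}c_{ki}+c_{ij}c_{jl}c_{li}+c_{ik}c_{jl}+c_{il}c_{jk}}{\sin^2(a_{ij})},\qquad c_{rs}=\cos(a_{rs}).$$ (v) $P^{ij}_{rs}=P^{i'j'}_{r's'}$ whenever $\{i,j\}\neq\{r,s\}$, where for a two-element subset $\{a,b\}\subset\{1,2,3,4\}$ the set $\{a',b'\}$ denotes the complement $\{1,2,3,4\}\setminus\{a,b\}$.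
   Context: $\mathbf{S}^3$, $\mathbf{H}^3$, $\mathbf{E}^3$ denote the 3-dimensional spherical, hyperbolic and Euclidean spaces, of constant curvature $1$, $-1$, $0$ respectively. A tetrahedron means a (non-degenerate) geodesic tetrahedron with its four vertices in the space. The dihedral angle at an edge is the interior angle between the two faces meeting along that edge. A tetrahedron in a fixed geometry is determined up to isometry by its six edge lengths, so each dihedral angle is a function of the six lengths, and $\partial a_{ij}/\partial x_{rs}$ is the partial derivative with respect to $x_{rs}$ with the other five lengths held fixed. All quantities are indexed by unordered pairs (edges), so $P^{ij}_{rs}=P^{ji}_{rs}=P^{ij}_{sr}$ and $c_{rs}=c_{sr}$. *)

(* Defs.v *)
From HB Require Import structures.
From mathcomp Require Import all_boot all_order all_algebra.
From mathcomp Require Import all_classical all_reals all_analysis.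
Set Implicit Arguments.
Unset Strict Implicit.
Unset Printing Implicit Defensive.
Import Order.TTheory GRing.Theory Num.Theory.
Import numFieldNormedType.Exports.
Local Open Scope classical_set_scope.
Local Open Scope ring_scope.

Inductive geometry := Spherical | Hyperbolic | Euclidean.

(* S^3 is the unit sphere of R^4, H^3 the upper sheet of the hyperboloid in
   R^{3,1}, and E^3 is R^3 itself. The ambient space is R^(dim_pred K).+1, so
   that coordinate ord0 always exists. *)
Definition dim_pred (K : geometry) : nat :=
  match K with Spherical | Hyperbolic => 3 | Euclidean => 2 end.

Notation ambient R K := 'rV[R]_(dim_pred K).+1.

(* Lorentzian for H^3, with ord0 the time coordinate. *)
Definition form (R : realType) (K : geometry) (u w : ambient R K) : R :=
  match K with
  | Hyperbolic => \sum_i (if i == ord0 then -1 else 1) * u 0 i * w 0 i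
  | Spherical | Euclidean => \sum_i u 0 i * w 0 i
  end.

Definition in_space (R : realType) (K : geometry) (p : ambient R K) : Prop :=
  match K with
  | Spherical => form p p = 1
  | Hyperbolic => form p p = -1 /\ 0 < p 0 ord0
  | Euclidean => True
  end.

Definition arcosh (R : realType) (t : R) : R := ln (t + Num.sqrt (t ^+ 2 - 1)).

Definition dist (R : realType) (K : geometry) (p q : ambient R K) : R :=
  match K with
  | Spherical => acos (form p q)
  | Hyperbolic => arcosh (- form p q)
  | Euclidean => Num.sqrt (form (p - q) (p - q))
  end.

(* The vertices do not lie in one totally geodesic plane: they are linearly
   independent in R^4 for S^3 and H^3, affinely independent for E^3. *)
Definition nondegenerate (R : realType) (K : geometry)
    (v : 'I_4 -> ambient R K) : Prop :=
  match K with
  | Spherical | Hyperbolic => row_free (\matrix_(i < 4) v i)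
  | Euclidean => row_free (\matrix_(i < 3) (v (lift ord0 i) - v ord0))
  end.

Definition tetrahedron (R : realType) (K : geometry)
    (v : 'I_4 -> ambient R K) : Prop :=
  (forall i, in_space (v i)) /\ nondegenerate v.

(* A positive multiple of the initial velocity at p of the geodesic from p
   to q: for S^3 and H^3, the projection of q to the tangent space at p. *)
Definition direction (R : realType) (K : geometry) (p q : ambient R K) :
    ambient R K :=
  match K with
  | Spherical | Hyperbolic => q - (form p q / form p p) *: p
  | Euclidean => q - p
  end.

Definition orth_part (R : realType) (K : geometry) (u w : ambient R K) :
    ambient R K :=
  w - (form u w / form u u) *: u.

Definition vangle (R : realType) (K : geometry) (u w : ambient R K) : R :=
  acos (form u w / (Num.sqrt (form u u) * Num.sqrt (form w w))).

(* The interior angle along pq between the faces pqr and pqs, measured in the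
   tangent space at p: it is the angle between the vectors orthogonal to pq
   that point from the edge into the two faces. *)
Definition dihedral (R : realType) (K : geometry) (p q r s : ambient R K) : R :=
  vangle (orth_part (direction p q) (direction p r))
         (orth_part (direction p q) (direction p s)).

(* Edges are the two-element sets of vertex labels, and a system of edge
   lengths is a function on {set 'I_4} of which only the six values at edges
   are used. *)
Definition is_edge (e : {set 'I_4}) : bool := #|e| == 2%N.

Definition end0 (e : {set 'I_4}) : 'I_4 := nth ord0 (enum e) 0.
Definition end1 (e : {set 'I_4}) : 'I_4 := nth ord0 (enum e) 1.

Definition edge_length (R : realType) (K : geometry)
    (v : 'I_4 -> ambient R K) (e : {set 'I_4}) : R :=
  dist (v (end0 e)) (v (end1 e)).

Definition edge_angle (R : realType) (K : geometry)
    (v : 'I_4 -> ambient R K) (e : {set 'I_4}) : R :=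
  dihedral (v (end0 e)) (v (end1 e)) (v (end0 (~: e))) (v (end1 (~: e))).

Definition realizes (R : realType) (K : geometry)
    (x : {set 'I_4} -> R) (v : 'I_4 -> ambient R K) : Prop :=
  tetrahedron v /\ forall e, is_edge e -> edge_length v e = x e.

(* The dihedral angle at e as a function of the six edge lengths. The
   tetrahedron with lengths x is unique up to isometry, so the choice made by
   xget is immaterial; the value is junk when no tetrahedron has lengths x. *)
Definition angle_of_lengths (R : realType) (K : geometry) (e : {set 'I_4})
    (x : {set 'I_4} -> R) : R :=
  edge_angle (xget (fun=> 0) [set v : 'I_4 -> ambient R K | realizes x v]) e.

Definition vary (R : realType) (x : {set 'I_4} -> R) (f : {set 'I_4}) (t : R) :
    {set 'I_4} -> R :=
  fun g => if g == f then t else x g.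

(* The partial derivative of a_e with respect to x_f at x is the derivative of
   this function at x f. *)
Definition angle_along (R : realType) (K : geometry) (e f : {set 'I_4})
    (x : {set 'I_4} -> R) : R -> R :=
  fun t => angle_of_lengths K e (vary x f t).

Definition Pcoef (R : realType) (K : geometry) (v : 'I_4 -> ambient R K)
    (e f : {set 'I_4}) : R :=
  (sin (edge_angle v e) * sin (edge_angle v f))^-1 *
  derive1 (angle_along K e f (edge_length v)) (edge_length v f).

(* Main.v *)
Require Import Defs.
From HB Require Import structures.
From mathcomp Require Import all_boot all_order all_algebra.
From mathcomp Require Import all_classical all_reals all_analysis.
From mathcomp Require Import ring lra.
Import Order.TTheory GRing.Theory Num.Theory.
Import numFieldNormedType.Exports.
(* Gives form back its ambient meaning, hidden by the sesquilinear forms. *)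
Import Defs.
Local Open Scope ring_scope.
Set Implicit Arguments.
Unset Strict Implicit.
Unset Printing Implicit Defensive.

(** The six lengths determine the matrix H of scalar products of a dual family:
    vectors u_a with <u_a, v_b> = delta_ab in the curved cases, the gradients of
    the barycentric coordinates in the flat case. The vector u_a is normal to
    the face opposite to v_a, so with h_ab = H_ab / sqrt (H_aa H_bb) the
    dihedral angle at the edge ij satisfies cos a_ij = - h_kl
    (dihedral_gram, edge_angle_gram).

    Let G_ab be <v_a, v_b>, or - |v_a - v_b|^2 / 2 in the flat case; it is a
    function of the distance whose derivative is - sin x, - sinh x or - x.
    In the curved cases H is the inverse of G. In the flat case it is the
    corresponding block of the inverse of G bordered by ones. Either way a change
    of G changes H by the resolvent identity H' - H = - H (G' - G) H'
    (gram_resolvent), and when only the entry ij moves by e this is a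
    2 x 2 linear system whose solution is an explicit rational function of e
    (gram_perturbation). To know that nearby lengths are realized at all, one
    moves the vertex v_j inside v_j + span (u_i, u_j) (move_vertex). Hence near
    the given lengths every angle is an explicit differentiable function of the
    varied length (angle_along_near), and differentiating it gives
      d a_ab / d x_ij = s_ij sqrt (H_ii H_jj) T / sin a_ab,
      T = h_ci h_dj + h_cj h_di - h_cd (h_ci h_cj + h_di h_dj),
    where cd is the edge opposite to ab and s_ij is sin x_ij, sinh x_ij or x_ij
    (is_derive_angle_along).

    By the sine law s_ij^2 is, up to one factor common to all edges, the
    minor H_kk H_ll - H_kl^2 = H_kk H_ll (sin a_ij)^2 (sine_law). Therefore
    P = Q T / (sin a_ab)^2 with a constant Q that does not depend on the edges
    (Pcoef_gram). This quotient is Q for opposite edges and Q h_il for the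
    adjacent edges ij and ik; both values are visibly symmetric and invariant
    under complements, and the numerator of w_ij is T for equal edges. *)

(** * The ambient bilinear form *)

#[local] Arguments form : simpl never.

Definition flat (K : geometry) : bool :=
  if K is Euclidean then true else false.

Definition weight (R : realType) (K : geometry) (i : 'I_(dim_pred K).+1) : R :=
  match K with
  | Hyperbolic => if val i == 0%N then -1 else 1
  | Spherical | Euclidean => 1
  end.

Lemma formE (R : realType) (K : geometry) (u w : ambient R K) :
  form u w = \sum_i weight R i * (u 0 i * w 0 i).
Proof.
rewrite /form /weight; case: K u w => u w;
  by apply: eq_bigr => i _; rewrite ?mul1r ?mulrA.
Qed.

Lemma formC (R : realType) (K : geometry) (u w : ambient R K) :
  form u w = form w u.
Proof. by rewrite !formE; apply: eq_bigr => i _; rewrite (mulrC (u _ _)). Qed.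

Lemma formDr (R : realType) (K : geometry) (u w z : ambient R K) :
  form u (w + z) = form u w + form u z.
Proof.
rewrite !formE -big_split /=; apply: eq_bigr => i _; rewrite !mxE; ring.
Qed.

Lemma formZr (R : realType) (K : geometry) (a : R) (u w : ambient R K) :
  form u (a *: w) = a * form u w.
Proof.
rewrite !formE mulr_sumr; apply: eq_bigr => i _; rewrite !mxE; ring.
Qed.

Lemma form0r (R : realType) (K : geometry) (u : ambient R K) : form u 0 = 0.
Proof. by rewrite -(scale0r 0) formZr mul0r. Qed.

Lemma formNr (R : realType) (K : geometry) (u w : ambient R K) :
  form u (- w) = - form u w.
Proof. by rewrite -scaleN1r formZr mulN1r. Qed.

Lemma formBr (R : realType) (K : geometry) (u w z : ambient R K) :
  form u (w - z) = form u w - form u z.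
Proof. by rewrite formDr formNr. Qed.

Lemma form_sumr (R : realType) (K : geometry) (I : Type) (s : seq I)
    (P : pred I) (u : ambient R K) (F : I -> ambient R K) :
  form u (\sum_(i <- s | P i) F i) = \sum_(i <- s | P i) form u (F i).
Proof.
by apply: (big_morph (form u)); [move=> x y; apply: formDr | apply: form0r].
Qed.

Lemma formDl (R : realType) (K : geometry) (u w z : ambient R K) :
  form (w + z) u = form w u + form z u.
Proof. by rewrite formC formDr !(formC u). Qed.

Lemma formZl (R : realType) (K : geometry) (a : R) (u w : ambient R K) :
  form (a *: w) u = a * form w u.
Proof. by rewrite formC formZr (formC u). Qed.

Lemma formBl (R : realType) (K : geometry) (u w z : ambient R K) :
  form (w - z) u = form w u - form z u.
Proof. by rewrite formC formBr !(formC u). Qed.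

Lemma formNl (R : realType) (K : geometry) (u w : ambient R K) :
  form (- w) u = - form w u.
Proof. by rewrite formC formNr (formC u). Qed.

Lemma form_suml (R : realType) (K : geometry) (I : Type) (s : seq I)
    (P : pred I) (u : ambient R K) (F : I -> ambient R K) :
  form (\sum_(i <- s | P i) F i) u = \sum_(i <- s | P i) form (F i) u.
Proof. by rewrite formC form_sumr; apply: eq_bigr => i _; apply: formC. Qed.

Definition form_bilin := (formDl, formDr, formNl, formNr, formZl, formZr).

Lemma sum_sqr_gt0 (R : realType) (n : nat) (x : 'rV[R]_n) :
  x != 0 -> 0 < \sum_i x 0 i * x 0 i.
Proof.
move=> /eqP x0; rewrite lt_neqAle eq_sym andbC sumr_ge0 => [|i _]; last first.
  by rewrite -expr2 sqr_ge0.
apply/negP => /eqP /psumr_eq0P h; apply: x0; apply/rowP => i; rewrite mxE.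
have /eqP := h (fun i _ => sqr_ge0 (x 0 i)) i isT.
by rewrite mulf_eq0 orbb => /eqP.
Qed.

Lemma form_hyperbolicE (R : realType) (u w : ambient R Hyperbolic) :
  form u w = - (u 0 ord0 * w 0 ord0)
             + \sum_(i < 3) u 0 (lift ord0 i) * w 0 (lift ord0 i).
Proof.
rewrite formE big_ord_recl /weight /= mulN1r; congr (_ + _).
by apply: eq_bigr => i _; rewrite mul1r.
Qed.

Lemma cauchy_schwarz (R : realType) (n : nat) (x y : 'I_n -> R) :
  (\sum_i x i * y i) ^+ 2 <= (\sum_i x i * x i) * (\sum_i y i * y i).
Proof.
set C := \sum_i x i * y i; set A := \sum_i x i * x i; set B := \sum_i y i * y i.
have B_ge0 : 0 <= B by apply: sumr_ge0 => i _; rewrite -expr2 sqr_ge0.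
have [B0|B_neq0] := eqVneq B 0.
  have y0 i : y i = 0.
    have h := psumr_eq0P (fun i _ => sqr_ge0 (y i)) B0; have /eqP := h i isT.
    by rewrite mulf_eq0 orbb => /eqP.
  rewrite /C big1 => [|i _]; last by rewrite y0 mulr0.
  by rewrite B0 mulr0 expr0n.
have : 0 <= \sum_i (x i * B - y i * C) ^+ 2 by apply: sumr_ge0 => i _; apply: sqr_ge0.
rewrite (_ : \sum_i _ = B * (A * B - C ^+ 2)).
  by rewrite pmulr_rge0 ?subr_ge0 // lt0r B_neq0.
rewrite (eq_bigr (fun i => x i * x i * B ^+ 2 - x i * y i * (2 * B * C)
  + y i * y i * C ^+ 2)) => [|i _]; last by ring.
by rewrite big_split sumrB -!mulr_suml /= -/A -/B -/C; ring.
Qed.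

(** Tangent vectors have positive norm, which makes angles between them
    meaningful. Only the hyperboloid needs an argument: if x is orthogonal to p,
    Cauchy-Schwarz for the space coordinates bounds (x_0 p_0)^2 by
    |x_space|^2 (p_0^2 - 1). *)
Lemma form_gt0 (R : realType) (K : geometry) (p x : ambient R K) :
  in_space p -> (~~ flat K -> form x p = 0) -> x != 0 -> 0 < form x x.
Proof.
case: K p x => p x.
- by move=> _ _ /sum_sqr_gt0.
- rewrite /in_space => -[pp p0] /(_ isT) xp x0.
  have := cauchy_schwarz (fun i => x 0 (lift ord0 i)) (fun i => p 0 (lift ord0 i)).
  have S_ge0 : 0 <= \sum_i x 0 (lift ord0 i) * x 0 (lift ord0 i).
    by apply: sumr_ge0 => i _; rewrite -expr2 sqr_ge0.
  have := sum_sqr_gt0 x0; rewrite big_ord_recl => tS.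
  move: pp xp tS; rewrite !form_hyperbolicE.
  move: S_ge0 p0; move: (x 0 ord0) (p 0 ord0) (\sum_i _) (\sum_i _) (\sum_i _).
  move=> t s C P S S_ge0 s_gt0 PE CE tS.
  have {PE}-> : P = s * s - 1 by lra.
  have {CE}-> : C = t * s by lra.
  rewrite -(pmulr_lgt0 _ (mulr_gt0 s_gt0 s_gt0)) => cs.
  have [S0|S_gt0] := eqVneq S 0.
    have t0 : 0 < t ^+ 2 by move: tS; rewrite S0 addr0 expr2.
    suff : 0 < (t * s) ^+ 2 by move: cs; rewrite S0 mul0r; lra.
    by rewrite exprMn mulr_gt0 // exprn_gt0.
  have {}S_gt0 : 0 < S by rewrite lt0r S_gt0.
  by move: cs; rewrite exprMn => cs; lra.
- by move=> _ _ /sum_sqr_gt0.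
Qed.

(** * Dual families *)

(** Two situations in one predicate. In the curved cases u is the basis dual to
    v. In the flat case the u_a are the gradients of the barycentric coordinates:
    they sum to zero, and <u_a, v_b> is only determined up to a constant o_a,
    which disappears when u_a is paired with a difference of vertices. *)
Definition dual_family (R : realType) (K : geometry)
    (v u : 'I_4 -> ambient R K) : Prop :=
  [/\ exists o : 'I_4 -> R,
        forall a b, form (u a) (v b) = (a == b)%:R - (flat K)%:R * o a,
      flat K -> \sum_a u a = 0
    & forall x, x = \sum_a form x (v a) *: u a].

Lemma form_mx (R : realType) (K : geometry) (m n : nat)
    (A : 'M[R]_(m, (dim_pred K).+1)) (B : 'M[R]_(n, (dim_pred K).+1)) a b :
  form (row a A) (row b B) =
  (A *m diag_mx (\row_i weight R i) *m B^T) a b.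
Proof.
rewrite formE !mxE; apply: eq_bigr => i _.
rewrite mul_mx_diag !mxE; ring.
Qed.

Lemma weight_mx_unit (R : realType) (K : geometry) :
  diag_mx (\row_(i < (dim_pred K).+1) weight R i) \in unitmx.
Proof.
rewrite unitmxE det_diag unitfE; apply/prodf_neq0 => i _; rewrite mxE /weight.
by case: K i => i; rewrite ?oner_eq0 //; case: (val i == 0%N); rewrite ?oppr_eq0 oner_eq0.
Qed.

Lemma dual_basis (R : realType) (K : geometry) (A : 'M[R]_((dim_pred K).+1)) :
  row_free A ->
  exists U : 'M[R]_((dim_pred K).+1),
    (forall a b, form (row a U) (row b A) = (a == b)%:R)
    /\ forall x, x = \sum_a form x (row a A) *: row a U.
Proof.
rewrite row_free_unit => Aunit; pose J := diag_mx (\row_i @weight R K i).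
have JAu : J *m A^T \in unitmx by rewrite unitmx_mul weight_mx_unit unitmx_tr.
exists (invmx (J *m A^T)); split=> [a b|x].
  by rewrite form_mx -mulmxA mulVmx // mxE.
rewrite [LHS](_ : _ = x *m (J *m A^T) *m invmx (J *m A^T)); last first.
  by rewrite mulmxK.
rewrite [LHS]mulmx_sum_row; apply: eq_bigr => a _; congr (_ *: _).
by rewrite mulmxA -form_mx; congr (form _ _); apply/rowP => i; rewrite !mxE.
Qed.

Lemma dual_family_exists (R : realType) (K : geometry)
    (v : 'I_4 -> ambient R K) :
  nondegenerate v -> exists u, dual_family v u.
Proof.
case: K v => v nd.
- have [U [dU xU]] := @dual_basis R Spherical (\matrix_(i < 4) v i) nd.
  exists (fun a => row a U); split=> //.
  + exists (fun=> 0) => a b; rewrite mulr0 subr0 -dU; congr form.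
    by apply/rowP => i; rewrite !mxE.
  + move=> x; rewrite [LHS]xU; apply: eq_bigr => a _; congr (form _ _ *: _).
    by apply/rowP => i; rewrite !mxE.
- have [U [dU xU]] := @dual_basis R Hyperbolic (\matrix_(i < 4) v i) nd.
  exists (fun a => row a U); split=> //.
  + exists (fun=> 0) => a b; rewrite mulr0 subr0 -dU; congr form.
    by apply/rowP => i; rewrite !mxE.
  + move=> x; rewrite [LHS]xU; apply: eq_bigr => a _; congr (form _ _ *: _).
    by apply/rowP => i; rewrite !mxE.
- have [U [dU xU]] := @dual_basis R Euclidean _ nd.
  have rE b : row b (\matrix_(i < 3) (v (lift ord0 i) - v ord0))
      = v (lift ord0 b) - v ord0 by apply/rowP => i; rewrite !mxE.
  have [u [u0 uS]] : exists u : 'I_4 -> ambient R Euclidean,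
      u ord0 = - \sum_b row b U /\ forall b, u (lift ord0 b) = row b U.
    exists (fun a => if unlift ord0 a is Some b then row b U else - \sum_b row b U).
    by split=> [|b]; rewrite ?unlift_none ?liftK.
  exists u; split=> [|_|x].
  + exists (fun a => (a == ord0)%:R - form (u a) (v ord0)) => a b.
    rewrite mul1r opprB addrCA [form (u a) (v ord0) + _]addrC.
    rewrite -[LHS](subrK (form (u a) (v ord0))); congr (_ + _).
    rewrite -formBr; case: (unliftP ord0 b) => [b'|] ->; last first.
      by rewrite subrr form0r subrr.
    rewrite -rE; case: (unliftP ord0 a) => [a'|] ->.
      by rewrite uS dU (inj_eq lift_inj) [_ == ord0]eq_sym (negPf (neq_lift _ _)) subr0.
    rewrite u0 formNl form_suml (bigD1 b') //= dU eqxx.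
    rewrite big1 ?addr0; last by move=> c /negPf cb; rewrite dU cb.
    by rewrite sub0r.
  + by rewrite big_ord_recl u0 (eq_bigr _ (fun b _ => uS b)) addNr.
  + rewrite [LHS]xU [RHS]big_ord_recl u0 scalerN scaler_sumr addrC -sumrB.
    by apply: eq_bigr => b _; rewrite rE formBr scalerBl uS.
Qed.

(** Linear independence in the curved cases and affine independence in the flat
    case become one condition on the coefficients y. *)
Lemma independent_nondegenerate (R : realType) (K : geometry)
    (v : 'I_4 -> ambient R K) :
  (forall y : 'I_4 -> R, (flat K -> \sum_a y a = 0) ->
     \sum_a y a *: v a = 0 -> forall a, y a = 0) ->
  nondegenerate v.
Proof.
have mulE (V : 'I_4 -> 'rV[R]_4) (y : 'rV_4) :
    y *m (\matrix_i V i) = \sum_a y 0 a *: V a.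
  by rewrite mulmx_sum_row; apply: eq_bigr => a _; rewrite rowK.
case: K v => v ind.
- apply: inj_row_free => y; rewrite mulE => yv.
  by apply/rowP => a; rewrite mxE; apply: (ind _ _ yv).
- apply: inj_row_free => y; rewrite mulE => yv.
  by apply/rowP => a; rewrite mxE; apply: (ind _ _ yv).
- apply: inj_row_free => y; rewrite mulmx_sum_row => yv.
  have [z [z0 zS]] : exists z : 'I_4 -> R,
      z ord0 = - \sum_b y 0 b /\ forall b, z (lift ord0 b) = y 0 b.
    exists (fun a => if unlift ord0 a is Some b then y 0 b else - \sum_b y 0 b).
    by split=> [|b]; rewrite ?unlift_none ?liftK.
  apply/rowP => b; rewrite mxE -zS; apply: ind => [_|].
    by rewrite big_ord_recl z0 (eq_bigr _ (fun b _ => zS b)) addNr.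
  rewrite big_ord_recl z0 scaleNr scaler_suml addrC -sumrB -[RHS]yv.
  by apply: eq_bigr => a _; rewrite rowK zS scalerBr.
Qed.

(** * Gram matrices of dual families *)

(** In the flat case this is - |p - q|^2 / 2, so that in each geometry the
    pairing of two points is a function of their distance alone. *)
Definition pairing (R : realType) (K : geometry) (p q : ambient R K) : R :=
  form p q - (flat K)%:R / 2 * (form p p + form q q).

Lemma pairingC (R : realType) (K : geometry) (p q : ambient R K) :
  pairing p q = pairing q p.
Proof. by rewrite /pairing formC addrC [form q q + _]addrC addrC. Qed.

Lemma dual_sum0 (R : realType) (K : geometry) (v u : 'I_4 -> ambient R K) x :
  dual_family v u -> (flat K)%:R * (\sum_a form x (u a)) = 0.
Proof.
case=> _ s0 _; rewrite -form_sumr; case: (flat K) s0 => [/(_ isT) ->|_].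
  by rewrite form0r mulr0.
by rewrite mul0r.
Qed.

(** The pairing matrix inverts the Gram matrix of u, up to the border that is
    present in the flat case: expand v_c in the family u and pair with u_a. *)
Lemma gram_mul_pairing (R : realType) (K : geometry)
    (v u : 'I_4 -> ambient R K) :
  dual_family v u -> exists w : 'I_4 -> R, forall a c,
    \sum_b form (u a) (u b) * pairing (v b) (v c)
    = (a == c)%:R - (flat K)%:R * w a.
Proof.
move=> du; have [[w0 ou] s0 xu] := du.
exists (fun a => w0 a + (\sum_b form (u a) (u b) * form (v b) (v b)) / 2) => a c.
have -> : \sum_b form (u a) (u b) * pairing (v b) (v c)
    = form (u a) (\sum_b form (v c) (v b) *: u b)
      - (flat K)%:R / 2 * (\sum_b form (u a) (u b) * form (v b) (v b))
      - ((flat K)%:R * \sum_b form (u a) (u b)) * (form (v c) (v c) / 2).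
  rewrite form_sumr !mulr_sumr mulr_suml -!sumrB; apply: eq_bigr => b _.
  rewrite formZr /pairing (formC (v c) (v b)); ring.
rewrite -xu ou (dual_sum0 _ du); ring.
Qed.

(** Half of the resolvent identity. The border term of gram_mul_pairing is
    killed because the rows of the second Gram matrix sum to zero in the flat
    case. *)
Lemma gram_pairing_gram (R : realType) (K : geometry)
    (v u v' u' : 'I_4 -> ambient R K) :
  dual_family v u -> dual_family v' u' -> forall a d,
  \sum_b \sum_c form (u a) (u b) * pairing (v b) (v c) * form (u' c) (u' d)
  = form (u' a) (u' d).
Proof.
move=> du du' a d; have [w wE] := gram_mul_pairing du.
rewrite exchange_big /=.
under eq_bigr => c _ do rewrite -mulr_suml wE mulrBl.
rewrite sumrB (bigD1 a) //= eqxx mul1r big1 => [|c /negPf ca]; last first.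
  by rewrite eq_sym ca mul0r.
have -> : \sum_c (flat K)%:R * w a * form (u' c) (u' d)
    = w a * ((flat K)%:R * \sum_c form (u' d) (u' c)).
  by rewrite !mulr_sumr; apply: eq_bigr => c _; rewrite (formC (u' d)); ring.
by rewrite (dual_sum0 _ du') mulr0 subr0 addr0.
Qed.

(** Evaluate H G H' and H G' H' with the preceding lemma and subtract. For
    G = G' this says that the dual Gram matrix depends on the pairings only. *)
Lemma gram_resolvent (R : realType) (K : geometry)
    (v u v' u' : 'I_4 -> ambient R K) :
  dual_family v u -> dual_family v' u' -> forall a d,
  form (u' a) (u' d) = form (u a) (u d)
    - \sum_b \sum_c form (u a) (u b)
        * (pairing (v' b) (v' c) - pairing (v b) (v c)) * form (u' c) (u' d).
Proof.
move=> du du' a d.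
rewrite -[form (u a) (u d)]formC -(gram_pairing_gram du' du d a).
rewrite [X in _ = X - _]exchange_big -sumrB /=.
rewrite -[LHS](gram_pairing_gram du du'); apply: eq_bigr => b _.
rewrite -sumrB; apply: eq_bigr => c _.
rewrite (formC (u' d)) (formC (u b)) (pairingC (v' c)); ring.
Qed.

Definition edge_mark (R : realType) (i j b c : 'I_4) : R :=
  ((b == i) && (c == j))%:R + ((b == j) && (c == i))%:R.

Lemma sum_edge_mark (R : realType) (i j : 'I_4) (F : 'I_4 -> 'I_4 -> R) :
  \sum_b \sum_c edge_mark R i j b c * F b c = F i j + F j i.
Proof.
have one k l : \sum_b \sum_c ((b == k) && (c == l))%:R * F b c = F k l.
  rewrite (bigD1 k) //= (bigD1 l) //= !eqxx mul1r !big1 ?addr0 //.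
    by move=> b /negPf bk; rewrite big1 // => c _; rewrite bk mul0r.
  by move=> c /negPf cl; rewrite cl mul0r.
rewrite -(one i j) -(one j i) -big_split /=; apply: eq_bigr => b _.
by rewrite -big_split /=; apply: eq_bigr => c _; rewrite mulrDl.
Qed.

(** Determinant of the 2 x 2 system for column b of the perturbed Gram matrix,
    whose unknowns are the entries at rows i and j. *)
Definition perturbed_det (R : realType) (H : 'I_4 -> 'I_4 -> R) (i j : 'I_4)
    (e : R) : R :=
  (1 + e * H i j) ^+ 2 - e ^+ 2 * (H i i * H j j).

(** Entry a b of the perturbed Gram matrix, multiplied by perturbed_det so that
    it is a polynomial in e; dihedral angles do not see the common factor. *)
Definition perturbed_gram (R : realType) (H : 'I_4 -> 'I_4 -> R) (i j : 'I_4)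
    (a b : 'I_4) (e : R) : R :=
  perturbed_det H i j e * H a b
  - e * (((1 + e * H i j) * H j b - e * H j j * H i b) * H a i
         + ((1 + e * H i j) * H i b - e * H i i * H j b) * H a j).

Lemma gram_perturbation (R : realType) (K : geometry)
    (v u v' u' : 'I_4 -> ambient R K) (i j : 'I_4) (e : R) :
  dual_family v u -> dual_family v' u' ->
  (forall b c, pairing (v' b) (v' c)
     = pairing (v b) (v c) + e * edge_mark R i j b c) ->
  let H a b := form (u a) (u b) in
  forall a b, perturbed_det H i j e * form (u' a) (u' b)
              = perturbed_gram H i j a b e.
Proof.
move=> du du' pE H a b.
have rE c : form (u' c) (u' b) = H c b
    - e * (H c i * form (u' j) (u' b) + H c j * form (u' i) (u' b)).
  rewrite (gram_resolvent du du') -(sum_edge_mark i j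
    (fun k l => H c k * form (u' l) (u' b))) mulr_sumr.
  congr (_ - _); apply: eq_bigr => k _; rewrite mulr_sumr; apply: eq_bigr => l _.
  rewrite pE /H; ring.
have Hji : H j i = H i j by rewrite /H formC.
(* Cramer's rule for the equations of rows i and j, then back into row a. *)
have := rE j; have := rE i; have := rE a.
rewrite /perturbed_gram /perturbed_det Hji.
move: (form (u' a) _) (form (u' i) _) (form (u' j) _) => X Y Z -> EY EZ.
have {}EY : Y * (1 + e * H i j) = H i b - e * (H i i * Z).
  by rewrite mulrDr mulr1 {1}EY; ring.
have {}EZ : Z * (1 + e * H i j) = H j b - e * (H j j * Y).
  by rewrite mulrDr mulr1 {1}EZ; ring.
set D := (1 + e * H i j) ^+ 2 - e ^+ 2 * (H i i * H j j).
have DZ : D * Z = (1 + e * H i j) * H j b - e * H j j * H i b.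
  have -> : H j b = Z * (1 + e * H i j) + e * (H j j * Y) by rewrite EZ subrK.
  have -> : H i b = Y * (1 + e * H i j) + e * (H i i * Z) by rewrite EY subrK.
  rewrite /D; ring.
have DY : D * Y = (1 + e * H i j) * H i b - e * H i i * H j b.
  have -> : H j b = Z * (1 + e * H i j) + e * (H j j * Y) by rewrite EZ subrK.
  have -> : H i b = Y * (1 + e * H i j) + e * (H i i * Z) by rewrite EY subrK.
  rewrite /D; ring.
rewrite -DZ -DY; ring.
Qed.

(** * Dihedral angles and the sine law *)

(** What the three geometries have in common about directions; c = 1 in the flat
    case makes the constants of a dual family cancel. *)
Lemma directionE (R : realType) (K : geometry) (p q : ambient R K) :
  in_space p -> exists c, [/\ direction p q = q - c *: p, flat K -> c = 1
    & ~~ flat K -> form (direction p q) p = 0].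
Proof.
have ortho : form p p != 0 -> form (q - (form p q / form p p) *: p) p = 0.
  by move=> pp; rewrite formBl formZl divfK // (formC q) subrr.
case: K p q ortho => p q ortho.
- rewrite /in_space => pp; exists (form p q / form p p); split=> // _.
  by apply: ortho; rewrite pp oner_eq0.
- move=> [pp _]; exists (form p q / form p p); split=> // _.
  by apply: ortho; rewrite pp oppr_eq0 oner_eq0.
- by move=> _; exists 1; split=> //; rewrite /direction scale1r.
Qed.

Lemma form_dual_direction (R : realType) (K : geometry)
    (v u : 'I_4 -> ambient R K) (i a b : 'I_4) :
  dual_family v u -> in_space (v i) -> b != i ->
  form (u b) (direction (v i) (v a)) = (b == a)%:R.
Proof.
move=> [[w0 ou] _ _] /(directionE (v a))[c [-> c1 _]] /negPf bi.
rewrite formBr formZr !ou bi.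
by case: (flat K) c1 => [/(_ isT) ->|_] /=; ring.
Qed.

Lemma form_dual_vertex (R : realType) (K : geometry)
    (v u : 'I_4 -> ambient R K) (i a : 'I_4) :
  dual_family v u -> a != i -> ~~ flat K -> form (u a) (v i) = 0.
Proof. by move=> [[w0 ou] _ _] /negPf ai /negPf K0; rewrite ou ai K0 mul0r subr0. Qed.

(** The family u without u_i is the basis of the tangent space at v_i dual to
    the directions of the other three vertices. *)
Lemma tangent_expansion (R : realType) (K : geometry)
    (v u : 'I_4 -> ambient R K) (i : 'I_4) (x : ambient R K) :
  dual_family v u -> in_space (v i) -> (~~ flat K -> form x (v i) = 0) ->
  x = \sum_(a | a != i) form x (direction (v i) (v a)) *: u a.
Proof.
move=> [_ s0 xu] sv xv.
have -> : \sum_(a | a != i) form x (direction (v i) (v a)) *: u a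
    = \sum_a (form x (v a) - form x (v i)) *: u a.
  rewrite [RHS](bigD1 i) //= subrr scale0r add0r; apply: eq_bigr => a _.
  have [c [-> c1 _]] := directionE (v a) sv; rewrite formBr formZr.
  case: (flat K) c1 xv => [/(_ isT) ->|_ /(_ isT) ->]; first by rewrite mul1r.
  by rewrite mulr0.
under eq_bigr do rewrite scalerBl.
rewrite sumrB -xu -scaler_sumr.
case: (flat K) s0 xv => [/(_ isT) -> _|_ /(_ isT) ->].
  by rewrite scaler0 subr0.
by rewrite scale0r subr0.
Qed.

Lemma uniq4_mem (i j k l : 'I_4) :
  uniq [:: i; j; k; l] -> [:: i; j; k; l] =i 'I_4.
Proof.
move=> un a; have [x _||_ ->] := @uniq_min_size _ _ (enum 'I_4) un.
- exact: mem_enum.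
- by rewrite size_enum_ord.
- exact: mem_enum.
Qed.

Lemma uniq4_big (T : Type) (idx : T) (op : Monoid.com_law idx)
    (i j k l : 'I_4) (P : pred 'I_4) (F : 'I_4 -> T) :
  uniq [:: i; j; k; l] ->
  \big[op/idx]_(a | P a) F a = \big[op/idx]_(a <- [:: i; j; k; l] | P a) F a.
Proof.
move=> un; apply: perm_big; apply: uniq_perm => //.
  by rewrite /index_enum -enumT enum_uniq.
by move=> a; rewrite uniq4_mem // mem_index_enum.
Qed.

Lemma uniq4_swap12 (i j k l : 'I_4) :
  uniq [:: i; j; k; l] -> uniq [:: j; i; k; l].
Proof. by rewrite (perm_uniq (permEl (perm_catCA [:: i] [:: j] [:: k; l]))). Qed.

Lemma uniq4_swap23 (i j k l : 'I_4) :
  uniq [:: i; j; k; l] -> uniq [:: i; k; j; l].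
Proof.
rewrite (@perm_uniq _ _ [:: i; k; j; l]) // perm_cons.
exact: (permEl (perm_catCA [:: j] [:: k] [:: l])).
Qed.

Lemma uniq4_swap34 (i j k l : 'I_4) :
  uniq [:: i; j; k; l] -> uniq [:: i; j; l; k].
Proof.
rewrite (@perm_uniq _ _ [:: i; j; l; k]) // !perm_cons.
exact: (permEl (perm_catC [:: k] [:: l])).
Qed.

Lemma uniq4_swap (i j k l : 'I_4) :
  uniq [:: i; j; k; l] -> uniq [:: k; l; i; j].
Proof. by rewrite (perm_uniq (permEl (perm_catC [:: i; j] [:: k; l]))). Qed.

Lemma uniq4_extend (i j : 'I_4) :
  i != j -> exists k l, uniq [:: i; j; k; l].
Proof.
move=> ij; have c2 : #|~: [set i; j]%SET| = 2%N.
  by have := cardsC [set i; j]%SET; rewrite cards2 ij card_ord => -[].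
have /eqP/cards2P[k [l [kl E]]] := c2.
exists k, l; apply: uniq4_swap; rewrite /= !inE !negb_or kl ij !andbT /=.
have : k \in ~: [set i; j]%SET by rewrite E !inE eqxx.
have : l \in ~: [set i; j]%SET by rewrite E !inE eqxx orbT.
by rewrite !inE !negb_or => -> ->.
Qed.

Lemma uniq4_from (i : 'I_4) : exists j k l, uniq [:: i; j; k; l].
Proof.
have [j [k un]] := uniq4_extend (neq_lift i ord0).
by exists (lift i ord0), j, k.
Qed.

Section Tetrahedron.
Variables (R : realType) (K : geometry) (v u : 'I_4 -> ambient R K).
Hypotheses (sv : forall i, in_space (v i)) (du : dual_family v u).
Local Notation H a b := (form (u a) (u b)).
Local Notation d i a := (direction (v i) (v a)).

Lemma direction_norm_gt0 i j : i != j -> 0 < form (d i j) (d i j).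
Proof.
move=> ij; have [c [_ _ dp]] := directionE (v j) (sv i).
apply: (form_gt0 (sv i)) => //; apply/eqP => d0.
have := form_dual_direction j du (sv i) (b := j).
rewrite d0 form0r eqxx eq_sym ij => /(_ isT) /eqP.
by rewrite eq_sym oner_eq0.
Qed.

Lemma gram_diag_gt0 a : 0 < H a a.
Proof.
have [i [j [l]]] := uniq4_from a; rewrite /= !inE !negb_or => /andP[/andP[ai _] _].
apply: (form_gt0 (sv i)) => [|]; first exact: form_dual_vertex.
apply/eqP => u0; have := form_dual_direction a du (sv i) ai.
by rewrite u0 formC form0r eqxx => /eqP; rewrite eq_sym oner_eq0.
Qed.

(** The combination H_bb u_a - H_ab u_b is tangent at any third vertex, and its
    norm is H_bb times the minor. *)
Lemma gram_minor_gt0 a b : a != b -> 0 < H a a * H b b - H a b ^+ 2.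
Proof.
move=> ab; have [i [j /uniq4_swap]] := uniq4_extend ab.
rewrite /= !inE !negb_or => /andP[/and3P[_ ia ib] _].
rewrite eq_sym in ia; rewrite eq_sym in ib.
pose x := H b b *: u a - H a b *: u b.
have xx : form x x = H b b * (H a a * H b b - H a b ^+ 2).
  rewrite /x !form_bilin (formC (u b) (u a)); ring.
rewrite -(pmulr_rgt0 _ (gram_diag_gt0 b)) -xx; apply: (form_gt0 (sv i)).
  by move=> K0; rewrite !form_bilin !(form_dual_vertex du) // !mulr0 subrr.
apply/eqP => x0; have : form x (d i a) = H b b.
  rewrite !form_bilin !(form_dual_direction _ du (sv i)) // eqxx.
  by rewrite eq_sym (negPf ab) mulr1 mulr0 subr0.
by rewrite x0 formC form0r => /esym/eqP; rewrite gt_eqF // gram_diag_gt0.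
Qed.

(** The part r of the direction of v_k orthogonal to the edge ij lies in the
    span of u_k and u_l. Its coordinates there are its products with the
    directions of v_k and v_l, and the two equations say that r pairs to 1 with
    u_k and to 0 with u_l. *)
Lemma orth_part_gram i j k l : uniq [:: i; j; k; l] ->
  let r := orth_part (d i j) (d i k) in
  r = form r (d i k) *: u k + form r (d i l) *: u l
  /\ form r (d i k) * H k k + form r (d i l) * H k l = 1
  /\ form r (d i k) * H k l + form r (d i l) * H l l = 0.
Proof.
move=> un r; move: (un).
rewrite /= !inE !negb_or => /andP[/and3P[ij ik il] /and3P[/andP[jk jl] kl _]].
have d_gt0 := direction_norm_gt0 ij.
have rj : form r (d i j) = 0.
  by rewrite /r /orth_part !form_bilin (formC (d i j)) divfK ?subrr ?gt_eqF.
have rv : ~~ flat K -> form r (v i) = 0.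
  move=> K0; have [_ [_ _ /(_ K0) e1]] := directionE (v j) (sv i).
  have [_ [_ _ /(_ K0) e2]] := directionE (v k) (sv i).
  by rewrite /r /orth_part !form_bilin e1 e2 mulr0 subrr.
have rE : r = form r (d i k) *: u k + form r (d i l) *: u l.
  rewrite {1}(tangent_expansion du (sv i) rv) (uniq4_big _ _ _ un).
  rewrite !big_cons big_nil eqxx (eq_sym j) (eq_sym k) (eq_sym l) ij ik il /=.
  by rewrite rj scale0r add0r addr0.
have ur a : a != i -> a != j -> form (u a) r = (a == k)%:R.
  move=> ai aj; rewrite /r /orth_part formBr formZr.
  by rewrite !(form_dual_direction _ du (sv i)) // (negPf aj) mulr0 subr0.
split=> //; split.
- rewrite -[RHS](_ : form (u k) r = 1); last by rewrite ur ?eqxx // eq_sym.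
  by rewrite [r in RHS]rE !form_bilin.
- rewrite -[RHS](_ : form (u l) r = 0); last first.
    by rewrite ur 1?eq_sym // (negPf kl).
  by rewrite [r in RHS]rE !form_bilin (formC (u l) (u k)).
Qed.

(** Solving the equations of orth_part_gram for the vectors r and s that point
    into the two faces gives their scalar products as H_ll, - H_kl and H_kk over
    the minor H_kk H_ll - H_kl^2. *)
Lemma dihedral_gram i j k l : uniq [:: i; j; k; l] ->
  dihedral (v i) (v j) (v k) (v l)
  = acos (- H k l / (Num.sqrt (H k k) * Num.sqrt (H l l))).
Proof.
move=> un; have un' := uniq4_swap34 un.
have kl : k != l by move: un; rewrite /= !inE => /and4P[_ _ -> _].
have [] := orth_part_gram un; have [] := orth_part_gram un'.
rewrite /dihedral /vangle; have := gram_minor_gt0 kl.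
set r := orth_part _ (d i k); set s := orth_part _ (d i l).
move: (form r (d i k)) (form r (d i l)) (form s (d i k)) (form s (d i l)).
rewrite (formC (u l) (u k)) => A B B' A' D_gt0 [sE [s1 s0]] [rE [r1 r0]].
have rr : form r r = A.
  rewrite rE !form_bilin (formC (u l) (u k)).
  transitivity (A * (A * H k k + B * H k l) + B * (A * H k l + B * H l l)).
    ring.
  by rewrite r1 r0 mulr1 mulr0 addr0.
have ss : form s s = A'.
  rewrite sE !form_bilin (formC (u l) (u k)).
  transitivity (A' * (A' * H l l + B' * H k l) + B' * (A' * H k l + B' * H k k)).
    ring.
  by rewrite s1 s0 mulr1 mulr0 addr0.
have rs : form r s = B.
  rewrite rE sE !form_bilin (formC (u l) (u k)).
  transitivity (A * (A' * H k l + B' * H k k) + B * (A' * H l l + B' * H k l)).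
    ring.
  by rewrite s1 s0 mulr1 mulr0 add0r.
rewrite rr ss rs; congr acos.
move: D_gt0 (gram_diag_gt0 k) (gram_diag_gt0 l) r1 r0 s1 s0.
move: (H k k) (H k l) (H l l) => a b c D_gt0 a0 c0 r1 r0 s1 s0.
set D := _ - _ in D_gt0.
have AE : A = c / D.
  rewrite -[LHS](mulfK (lt0r_neq0 D_gt0)); congr (_ / _); rewrite /D.
  transitivity (c * (A * a + B * b) - b * (A * b + B * c)); first by ring.
  by rewrite r1 r0 mulr1 mulr0 subr0.
have BE : B = - b / D.
  rewrite -[LHS](mulfK (lt0r_neq0 D_gt0)); congr (_ / _); rewrite /D.
  transitivity (a * (A * b + B * c) - b * (A * a + B * b)); first by ring.
  by rewrite r1 r0 mulr1 mulr0 sub0r.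
have A'E : A' = a / D.
  rewrite -[LHS](mulfK (lt0r_neq0 D_gt0)); congr (_ / _); rewrite /D.
  transitivity (a * (A' * c + B' * b) - b * (A' * b + B' * a)); first by ring.
  by rewrite s1 s0 mulr1 mulr0 subr0.
rewrite AE BE A'E !sqrtrM ?(ltW a0) ?(ltW c0) //.
have q2 : Num.sqrt D^-1 ^+ 2 = D^-1 by rewrite sqr_sqrtr // invr_ge0 ltW.
rewrite [X in _ / X](_ : _ = (Num.sqrt a * Num.sqrt c) * D^-1); last first.
  by move: q2; move: (Num.sqrt D^-1) => q <-; ring.
have a' : Num.sqrt a != 0 by rewrite gt_eqF // sqrtr_gt0.
have c' : Num.sqrt c != 0 by rewrite gt_eqF // sqrtr_gt0.
by field; rewrite a' c' lt0r_neq0.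
Qed.

(** Determinant of the Gram matrix of u_j, u_k, u_l. *)
Definition gram3 (j k l : 'I_4) : R :=
  H j j * (H k k * H l l - H k l ^+ 2)
  - H j k * (H j k * H l l - H j l * H k l)
  + H j l * (H j k * H k l - H k k * H j l).

(** In the tangent space at v_i the vectors u_j, u_k, u_l are dual to the three
    directions, so the Gram matrices are inverse to each other and a squared
    length of a direction is a cofactor over a determinant. *)
Lemma gram3_direction i j k l : uniq [:: i; j; k; l] ->
  gram3 j k l * form (d i j) (d i j) = H k k * H l l - H k l ^+ 2.
Proof.
move=> un; move: (un).
rewrite /= !inE !negb_or => /andP[/and3P[ij ik il] /and3P[/andP[jk jl] kl _]].
have dv : ~~ flat K -> form (d i j) (v i) = 0.
  by move=> K0; have [_ [_ _ /(_ K0) ->]] := directionE (v j) (sv i).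
have dE b : b != i -> (b == j)%:R =
    form (d i j) (d i j) * H j b + form (d i j) (d i k) * H k b
    + form (d i j) (d i l) * H l b.
  move=> bi; rewrite -(form_dual_direction _ du (sv i)) // formC.
  rewrite {1}(tangent_expansion du (sv i) dv) (uniq4_big _ _ _ un).
  rewrite !big_cons big_nil eqxx (eq_sym j) (eq_sym k) (eq_sym l) ij ik il /=.
  by rewrite addr0 !form_bilin !addrA.
have := dE j; rewrite eq_sym ij eqxx => /(_ isT) ej.
have := dE k; rewrite eq_sym ik eq_sym (negPf jk) => /(_ isT) ek.
have := dE l; rewrite eq_sym il eq_sym (negPf jl) => /(_ isT) el.
move: el ek ej; rewrite (formC (u k) (u j)) (formC (u l) (u j)) (formC (u l) (u k)).
move: (form (d i j) (d i j)) (form _ (d i k)) (form _ (d i l)) => X Y Z el ek ej.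
transitivity ((H k k * H l l - H k l ^+ 2) * (X * H j j + Y * H j k + Z * H j l)
  - (H j k * H l l - H j l * H k l) * (X * H j k + Y * H k k + Z * H k l)
  + (H j k * H k l - H k k * H j l) * (X * H j l + Y * H k l + Z * H l l)).
  rewrite /gram3; ring.
by rewrite -el -ek -ej /=; ring.
Qed.

Lemma direction_normC i j :
  form (d i j) (d i j) = form (d j i) (d j i).
Proof.
move: (sv i) (sv j); rewrite /direction.
case: K (v i) (v j) => p q.
- by move=> pp qq; rewrite !form_bilin pp qq (formC q p); field.
- by move=> [pp _] [qq _]; rewrite !form_bilin pp qq (formC q p); field.
- by move=> _ _; rewrite !form_bilin (formC q p); ring.
Qed.

(** The factor is gram3 of the three vertices other than i. It does not depend
    on i because the two directions along an edge have the same norm. *)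
Lemma sine_law : exists2 D : R, 0 < D & forall i j k l, uniq [:: i; j; k; l] ->
  D * form (d i j) (d i j) = H k k * H l l - H k l ^+ 2.
Proof.
have vertex_ratio (i : 'I_4) : exists D : R, forall j k l, uniq [:: i; j; k; l] ->
    D * form (d i j) (d i j) = H k k * H l l - H k l ^+ 2.
  have [j0 [k0 [l0 un0]]] := uniq4_from i; exists (gram3 j0 k0 l0) => j k l un.
  rewrite -(gram3_direction un); congr (_ * _).
  have mem a : i != a -> [|| a == j0, a == k0 | a == l0].
    by move=> ia; move: (uniq4_mem un0 a); rewrite !inE (eq_sym a i) (negPf ia).
  move: un; rewrite /= !inE !negb_or.
  move=> /andP[/and3P[/mem mj /mem mk /mem ml] /and3P[/andP[jk jl] kl _]].
  case/or3P: mj jk jl => /eqP ->; case/or3P: mk kl => /eqP ->;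
    rewrite ?eqxx //; case/or3P: ml => /eqP ->; rewrite ?eqxx // => *;
    rewrite /gram3 ?(formC (u k0) (u j0)) ?(formC (u l0) (u j0))
      ?(formC (u l0) (u k0)); ring.
have {vertex_ratio} [D DE] := choice vertex_ratio.
have N_gt0 := direction_norm_gt0.
have Dc i j : D i = D j.
  have [->//|ij] := eqVneq i j.
  have [k [l un]] := uniq4_extend ij.
  have N0 := lt0r_neq0 (N_gt0 _ _ ij).
  apply: (mulIf N0); rewrite (DE _ _ _ _ un) direction_normC.
  by rewrite (DE _ _ _ _ (uniq4_swap12 un)).
exists (D ord0) => [|i j k l un]; last by rewrite (Dc ord0 i) (DE _ _ _ _ un).
have [j [k [l un]]] := uniq4_from ord0.
move: un (un) => /DE DN.
rewrite /= !inE !negb_or => /andP[/and3P[ij _ _] /and3P[_ kl _]].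
by rewrite -(pmulr_lgt0 _ (N_gt0 _ _ ij)) DN gram_minor_gt0.
Qed.
End Tetrahedron.

(** * Lengths *)

(** The pairing of two points at distance t. *)
Definition length_pairing (R : realType) (K : geometry) (t : R) : R :=
  match K with
  | Spherical => cos t
  | Hyperbolic => - ((expR t + expR (- t)) / 2)
  | Euclidean => - (t ^+ 2 / 2)
  end.

(** Minus the derivative of length_pairing; its square at the length of an edge
    is the norm of the direction along that edge, by edge_lengthP. *)
Definition length_slope (R : realType) (K : geometry) (t : R) : R :=
  match K with
  | Spherical => sin t
  | Hyperbolic => (expR t - expR (- t)) / 2
  | Euclidean => t
  end.

(** An open set of lengths on which length_pairing is injective and
    length_slope is positive. *)
Definition length_ok (R : realType) (K : geometry) (t : R) : bool :=
  match K with
  | Spherical => 0 < t < pi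
  | Hyperbolic | Euclidean => 0 < t
  end.

Lemma is_derive_length_pairing (R : realType) (K : geometry) (t : R) :
  is_derive t 1 (@length_pairing R K) (- length_slope K t).
Proof.
case: K => /=; first exact: is_derive_cos.
- have h1 : is_derive t (1 : R) (fun s : R => expR (- s)) (- expR (- t)).
    apply: is_derive_eq; rewrite /GRing.scale /=; ring.
  apply: is_derive_eq; rewrite /GRing.scale /=; ring.
- apply: is_derive_eq; rewrite /GRing.scale /=; by field.
Qed.

Lemma length_slope_gt0 (R : realType) (K : geometry) (t : R) :
  length_ok K t -> 0 < length_slope K t.
Proof.
case: K => //= t0; first exact: sin_gt0_pi.
by rewrite divr_gt0 // subr_gt0 ltr_expR; lra.
Qed.

Lemma length_ok_near (R : realType) (K : geometry) (t : R) :
  length_ok K t -> \forall s \near t, length_ok K s.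
Proof.
case: K => /= [/andP[t0 tpi]|t0|t0]; try exact: lt_nbhsr.
near=> s; apply/andP; split; near: s; [exact: lt_nbhsr | exact: lt_nbhsl].
Unshelve. all: by end_near. Qed.

(** Cauchy-Schwarz for the space coordinates: the product of two unit timelike
    vectors has the sign opposite to that of the product of their times. *)
Lemma hyperbolic_time (R : realType) (p q : ambient R Hyperbolic) :
  form p p = -1 -> form q q = -1 ->
  (form p q + p 0 ord0 * q 0 ord0) ^+ 2 < (p 0 ord0 * q 0 ord0) ^+ 2.
Proof.
have := cauchy_schwarz (fun i => p 0 (lift ord0 i)) (fun i => q 0 (lift ord0 i)).
have P_ge0 : 0 <= \sum_i p 0 (lift ord0 i) * p 0 (lift ord0 i).
  by apply: sumr_ge0 => i _; rewrite -expr2 sqr_ge0.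
have Q_ge0 : 0 <= \sum_i q 0 (lift ord0 i) * q 0 (lift ord0 i).
  by apply: sumr_ge0 => i _; rewrite -expr2 sqr_ge0.
rewrite !form_hyperbolicE; move: P_ge0 Q_ge0.
move: (p 0 ord0) (q 0 ord0) (\sum_i _) (\sum_i _) (\sum_i _) => s t C Q P.
move=> P_ge0 Q_ge0 cs pp qq; rewrite addrAC addNr add0r; apply: (le_lt_trans cs).
have -> : (s * t) ^+ 2 = (P + 1) * (Q + 1).
  have -> : P + 1 = s * s by lra.
  have -> : Q + 1 = t * t by lra.
  by ring.
lra.
Qed.

Lemma hyperbolic_form_lt0 (R : realType) (p q : ambient R Hyperbolic) :
  in_space p -> in_space q -> form p q < 0.
Proof.
move=> [pp p0] [qq q0]; have := hyperbolic_time pp qq.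
have := mulr_gt0 p0 q0; move: (p 0 ord0 * _) (form p q) => m f m0.
by move=> h; rewrite ltNge; apply/negP => f0; nra.
Qed.

(** Lets the sheet of a moved vertex be read off from a pairing that does not
    change. *)
Lemma hyperbolic_sheet (R : realType) (p q : ambient R Hyperbolic) :
  in_space p -> form q q = -1 -> form p q < 0 -> in_space q.
Proof.
move=> [pp p0] qq pq; split=> //; rewrite -(pmulr_rgt0 _ p0).
have := hyperbolic_time pp qq; move: (p 0 ord0 * _) (form p q) pq => m f f0.
by move=> h; rewrite ltNge; apply/negP => m0; nra.
Qed.

Lemma pairing_diag (R : realType) (K : geometry) (p : ambient R K) :
  in_space p -> pairing p p = length_pairing K 0.
Proof.
rewrite /pairing; case: K p => p /=.
- by rewrite cos0 => ->; ring.
- by rewrite oppr0 expR0 => -[-> _]; field.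
- by move=> _; field.
Qed.

Lemma flat_pairing (R : realType) (p q : ambient R Euclidean) :
  pairing p q = - (form (p - q) (p - q) / 2).
Proof. by rewrite /pairing /= !form_bilin (formC q p); field. Qed.

Lemma distC (R : realType) (K : geometry) (p q : ambient R K) :
  dist p q = dist q p.
Proof.
rewrite /dist; case: K p q => p q; rewrite 1?formC //.
by rewrite -(opprB q p) formNl formNr opprK.
Qed.

Lemma in_space_transfer (R : realType) (K : geometry) (r p q : ambient R K) :
  in_space r -> in_space p -> pairing q q = pairing p p ->
  pairing r q = pairing r p -> in_space q.
Proof.
rewrite /pairing; case: K r p q => r p q //=; rewrite !mul0r !subr0.
  by move=> _ pp ->.
move=> sr sp qq rq; apply: (hyperbolic_sheet sr); first by rewrite qq; case: sp.
by rewrite rq; apply: hyperbolic_form_lt0.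
Qed.

(** The inverse functions used by the distance are applied inside their
    domain when the two points span a nondegenerate edge. *)
Lemma edge_lengthP (R : realType) (K : geometry) (p q : ambient R K) :
  in_space p -> in_space q -> 0 < form (direction p q) (direction p q) ->
  [/\ length_ok K (dist p q), length_pairing K (dist p q) = pairing p q
    & length_slope K (dist p q) ^+ 2 = form (direction p q) (direction p q)].
Proof.
case: K p q => p q.
- rewrite /in_space /direction => pp qq.
  have -> : form (q - (form p q / form p p) *: p) (q - (form p q / form p p) *: p)
      = 1 - form p q ^+ 2.
    by rewrite !form_bilin pp qq (formC q p); field.
  rewrite /pairing /= !mul0r subr0 => N0.
  have f1 : -1 < form p q < 1.
    by rewrite -ltr_norml -(expr_lt1 (ltn0Sn 1)) // real_normK ?num_real; lra.
  have f1' : -1 <= form p q <= 1 by case/andP: f1 => /ltW -> /ltW ->.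
  case/andP: (f1) => f2 f3; split.
  + by rewrite acos_gt0 ?acos_ltpi // ?(ltW f2) ?f2 ?(ltW f3) ?f3.
  + by rewrite acosK // in_itv.
  + by rewrite sin_acos // sqr_sqrtr ?ltW.
- move=> sp sq; have f0 := hyperbolic_form_lt0 sp sq.
  case: sp sq => [pp _] [qq _]; rewrite /direction.
  have -> : form (q - (form p q / form p p) *: p) (q - (form p q / form p p) *: p)
      = form p q ^+ 2 - 1.
    by rewrite !form_bilin pp qq (formC q p); field.
  rewrite /pairing /= !mul0r subr0 => N0; rewrite /arcosh sqrrN.
  set r := Num.sqrt _; have r0 : 0 < r by rewrite sqrtr_gt0.
  have r2 : r ^+ 2 = form p q ^+ 2 - 1 by rewrite sqr_sqrtr ?ltW.
  have y1 : 1 < - form p q + r by nra.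
  have y0 : 0 < - form p q + r by lra.
  have yV : expR (- ln (- form p q + r)) = - form p q - r.
    rewrite expRN lnK ?posrE //; apply: (mulfI (lt0r_neq0 y0)).
    rewrite divff ?lt0r_neq0 //.
    transitivity (form p q ^+ 2 - r ^+ 2); last by ring.
    by rewrite r2; ring.
  rewrite yV lnK ?posrE //; split.
  + by rewrite ln_gt0.
  + by field.
  + by rewrite -r2; field.
- move=> _ _ /= N0; rewrite flat_pairing /dist.
  have -> : form (p - q) (p - q) = form (direction p q) (direction p q).
    by rewrite /direction -(opprB q p) formNl formNr opprK.
  by rewrite sqrtr_gt0 sqr_sqrtr ?ltW.
Qed.

Lemma dist_of_pairing (R : realType) (K : geometry) (p q : ambient R K) (t : R) :
  length_ok K t -> pairing p q = length_pairing K t -> dist p q = t.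
Proof.
case: K p q => p q /=.
- move=> /andP[t0 tpi]; rewrite /pairing /= !mul0r subr0 => ->.
  by rewrite cosK // in_itv /= !ltW.
- move=> t0; rewrite /pairing /= !mul0r subr0 => ->; rewrite opprK /arcosh.
  have e1 : expR t * expR (- t) = 1 by rewrite expRN divff // gt_eqF ?expR_gt0.
  rewrite (_ : _ ^+ 2 - 1 = ((expR t - expR (- t)) / 2) ^+ 2); last first.
    by rewrite -[X in _ - X = _]e1; field.
  rewrite sqrtr_sqr gtr0_norm; last exact: (@length_slope_gt0 R Hyperbolic).
  by rewrite (_ : _ + _ = expR t) ?expRK //; field.
- move=> t0; rewrite flat_pairing => /eqP.
  rewrite eqr_opp => /eqP /(mulIf (invr_neq0 _)) -> //.
  by rewrite sqrtr_sqr gtr0_norm.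
Qed.

(** * Moving one vertex *)

(** Adding z = e u_i + m u_j to v_j changes, for every m, only the pairings of
    v_j with v_i and with itself in the curved cases. The remaining condition
    <z, z> = - 2 m keeps the norm of the vertex; in the flat case the same
    condition keeps its distances to v_k and v_l. It is a quadratic equation in
    m, solvable when perturbed_det is positive, and the square root q of
    perturbed_det is also the coefficient that keeps the new vertices
    independent. *)
Lemma move_vertex (R : realType) (K : geometry) (v u : 'I_4 -> ambient R K)
    (i j : 'I_4) (e : R) :
  (forall i, in_space (v i)) -> dual_family v u -> i != j ->
  let H a b := form (u a) (u b) in
  0 < perturbed_det H i j e ->
  exists2 v' : 'I_4 -> ambient R K, tetrahedron v' &
    forall b c, pairing (v' b) (v' c)
      = pairing (v b) (v c) + e * edge_mark R i j b c.
Proof.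
move=> sv du ij H det_gt0; have [[w0 ou] s0 _] := du.
have Hjj : H j j != 0 by rewrite lt0r_neq0 // (gram_diag_gt0 sv du).
pose q := Num.sqrt (perturbed_det H i j e).
have q2 : q ^+ 2 = perturbed_det H i j e by rewrite sqr_sqrtr ?ltW.
have q0 : q != 0 by rewrite gt_eqF // sqrtr_gt0.
pose m := (q - (1 + e * H i j)) / H j j.
have mE : m * H j j = q - (1 + e * H i j) by rewrite divfK.
pose z := e *: u i + m *: u j.
have zz : form z z = - (2 * m).
  apply: (mulIf Hjj); rewrite /z !form_bilin (formC (u j) (u i)) -!/(H _ _).
  transitivity ((m * H j j) ^+ 2 + 2 * (e * H i j) * (m * H j j)
    + e ^+ 2 * (H i i * H j j)); first by ring.
  transitivity (- (2 * (m * H j j))); last by ring.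
  have -> : e ^+ 2 * (H i i * H j j) = (1 + e * H i j) ^+ 2 - q ^+ 2.
    by rewrite q2 /perturbed_det; ring.
  by rewrite mE; ring.
have vz b : form (v b) z = e * (b == i)%:R + m * (b == j)%:R
    - (flat K)%:R * (e * w0 i + m * w0 j).
  by rewrite /z formC !form_bilin !ou !(eq_sym _ b); ring.
have uz a : form (u a) z = e * H a i + m * H a j.
  by rewrite /z formDr !formZr.
clearbody z; pose v' b := if b == j then v j + z else v b.
have v'j : v' j = v j + z by rewrite /v' eqxx.
have v'b b : b != j -> v' b = v b by rewrite /v' => /negPf ->.
have jj : pairing (v' j) (v' j) = pairing (v j) (v j).
  rewrite v'j /pairing !form_bilin (formC z (v j)) zz vz eqxx eq_sym (negPf ij) /=.
  by case: (flat K) => /=; field.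
have bj b : b != j -> pairing (v' b) (v' j) = pairing (v b) (v j) + e * (b == i)%:R.
  move=> /[dup] bj /negPf bj'; rewrite v'j (v'b _ bj) /pairing !form_bilin.
  rewrite (formC z (v j)) zz !vz eqxx bj' (eq_sym j) (negPf ij) /=.
  by case: (flat K) => /=; field.
have v'P b c : pairing (v' b) (v' c) = pairing (v b) (v c) + e * edge_mark R i j b c.
  rewrite /edge_mark; have [->|bj'] := eqVneq b j.
    have [->|cj] := eqVneq c j.
      by rewrite jj eq_sym (negPf ij) /=; ring.
    rewrite pairingC (bj _ cj) pairingC (eq_sym j) (negPf ij) /=; ring.
  have [->|cj] := eqVneq c j; last by rewrite !v'b // andbF /=; ring.
  by rewrite (bj _ bj') andbT /=; ring.
exists v' => //; split=> [b|].
  have [->|bj'] := eqVneq b j; last by rewrite v'b.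
  (* The product with a third vertex v_k is unchanged and fixes the sheet. *)
  have [k [l /uniq4_swap]] := uniq4_extend ij.
  rewrite /= !inE !negb_or => /andP[/and3P[_ ki kj] _].
  have := bj k kj; rewrite (v'b _ kj) (negPf ki) mulr0 addr0.
  exact: (in_space_transfer (sv k) (sv j) jj).
apply: independent_nondegenerate => y y0 yv'.
have yE a : y a + y j * (e * H a i + m * H a j) = 0.
  have : \sum_b y b *: v b + y j *: z = 0.
    rewrite -[RHS]yv'.
    rewrite (bigD1 j) //= [RHS](bigD1 j) //= v'j scalerDr addrAC.
    by congr (_ + _); apply: eq_bigr => b bj'; rewrite v'b.
  move=> /(congr1 (form (u a))); rewrite form0r formDr form_sumr formZr uz => <-.
  congr (_ + _).
  under eq_bigr => b _ do rewrite formZr ou mulrBr.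
  rewrite sumrB (bigD1 a) //= eqxx mulr1 big1 => [|b /negPf ba]; last first.
    by rewrite eq_sym ba mulr0.
  rewrite -mulr_suml addr0.
  case: (flat K) y0 => [/(_ isT) ->|_] /=; rewrite ?mul0r ?mulr0 ?subr0 //.
have yj : y j = 0.
  have := yE j; rewrite mE (_ : H j i = H i j); last exact: formC.
  rewrite [LHS](_ : _ = y j * q); last by ring.
  by move=> /eqP; rewrite mulf_eq0 (negPf q0) orbF => /eqP.
by move=> a; have := yE a; rewrite yj mul0r addr0.
Qed.

(** * Edges as two-element sets *)

Lemma uniq4_neq (i j k l : 'I_4) : uniq [:: i; j; k; l] ->
  [/\ i != j, i != k, i != l, j != k & (j != l) && (k != l)].
Proof.
rewrite /= !inE !negb_or.
by move=> /andP[/and3P[-> -> ->] /and3P[/andP[-> ->] -> _]].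
Qed.

Lemma is_edge_set2 (i j : 'I_4) : is_edge [set i; j]%SET = (i != j).
Proof. by rewrite /is_edge cards2; case: (i != j). Qed.

Lemma edge_ends (e : {set 'I_4}) : is_edge e ->
  end0 e != end1 e /\ e = [set end0 e; end1 e]%SET.
Proof.
rewrite /is_edge /end0 /end1 cardE => sz.
have := enum_uniq (mem e); have := mem_enum (mem e).
case: (enum e) sz => [|x [|y [|]]] //= _ me; rewrite inE andbT => xy; split=> //.
by apply/setP => z; rewrite !inE -[z \in e]me !inE.
Qed.

Lemma mem_edge_ends (e : {set 'I_4}) :
  is_edge e -> (end0 e \in e) && (end1 e \in e).
Proof.
by move=> /edge_ends[_ E]; rewrite {2 4}E !inE !eqxx orbT.
Qed.

Lemma edge_complement (i j k l : 'I_4) : uniq [:: i; j; k; l] ->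
  (~: [set i; j])%SET = [set k; l]%SET.
Proof.
move=> un; have := un => /uniq4_neq[ij ik il jk /andP[jl kl]].
apply/setP => a; rewrite !inE.
have := uniq4_mem un a; rewrite !inE.
by case/or4P => /eqP ->; rewrite ?eqxx ?orbT ?(negPf ik) ?(negPf il) ?(negPf jk)
  ?(negPf jl) ?(eq_sym k) ?(eq_sym l) ?(negPf ik) ?(negPf il) ?(negPf jk)
  ?(negPf jl).
Qed.

(** The enumeration of an edge may list its ends in either order, which does not
    matter for symmetric functions. *)
Lemma edge_pick (i j : 'I_4) (T : Type) (F : 'I_4 -> 'I_4 -> T) : i != j ->
  (forall a b, F a b = F b a) ->
  F (end0 [set i; j]%SET) (end1 [set i; j]%SET) = F i j.
Proof.
move=> ij FC; have := ij; rewrite -is_edge_set2 => /edge_ends[].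
move: (end0 _) (end1 _) => a b ab /setP E.
have := E i; have := E j; rewrite !inE !eqxx ?orbT /=.
move=> /esym/orP[] /eqP ej /esym/orP[] /eqP ei.
- by rewrite ei ej eqxx in ij.
- by rewrite ei ej FC.
- by rewrite ei ej.
- by rewrite ei ej eqxx in ij.
Qed.

Variant edge_pair_spec : {set 'I_4} -> {set 'I_4} -> Prop :=
| SameEdge e : edge_pair_spec e e
| OppositeEdges i j k l of uniq [:: i; j; k; l] :
    edge_pair_spec [set i; j]%SET [set k; l]%SET
| AdjacentEdges i j k l of uniq [:: i; j; k; l] :
    edge_pair_spec [set i; j]%SET [set i; k]%SET.

Lemma edge_pairP (e f : {set 'I_4}) :
  is_edge e -> is_edge f -> edge_pair_spec e f.
Proof.
move=> /edge_ends[+ ->] /edge_ends[+ ->].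
move: (end0 e) (end1 e) (end0 f) (end1 f) => i j r s ij.
have [k [l un]] := uniq4_extend ij.
have unl := uniq4_swap34 un; have unj := uniq4_swap12 un.
have unlj := uniq4_swap12 unl.
have := uniq4_mem un s; have := uniq4_mem un r; rewrite !inE.
case/or4P => /eqP -> /or4P[] /eqP ->; rewrite ?eqxx // => _.
- exact: SameEdge.
- exact: AdjacentEdges un.
- exact: AdjacentEdges unl.
- by rewrite [X in edge_pair_spec _ X]finset.setUC; apply: SameEdge.
- by rewrite [X in edge_pair_spec X _]finset.setUC; apply: AdjacentEdges unj.
- by rewrite [X in edge_pair_spec X _]finset.setUC; apply: AdjacentEdges unlj.
- by rewrite [X in edge_pair_spec _ X]finset.setUC; apply: AdjacentEdges un.
- rewrite [X in edge_pair_spec _ X]finset.setUC [X in edge_pair_spec X _]finset.setUC.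
  exact: AdjacentEdges unj.
- exact: OppositeEdges un.
- by rewrite [X in edge_pair_spec _ X]finset.setUC; apply: AdjacentEdges unl.
- rewrite [X in edge_pair_spec _ X]finset.setUC [X in edge_pair_spec X _]finset.setUC.
  exact: AdjacentEdges unlj.
- by rewrite [X in edge_pair_spec _ X]finset.setUC; apply: OppositeEdges un.
Qed.

Lemma edge_length_set2 (R : realType) (K : geometry)
    (v : 'I_4 -> ambient R K) (i j : 'I_4) :
  i != j -> edge_length v [set i; j]%SET = dist (v i) (v j).
Proof.
move=> ij; apply: (edge_pick (F := fun a b => dist (v a) (v b)) ij) => a b.
exact: distC.
Qed.

Definition normal_gram (R : realType) (K : geometry) (u : 'I_4 -> ambient R K)
    (a b : 'I_4) : R :=
  form (u a) (u b) / (Num.sqrt (form (u a) (u a)) * Num.sqrt (form (u b) (u b))).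

Lemma normal_gramC (R : realType) (K : geometry) (u : 'I_4 -> ambient R K) a b :
  normal_gram u a b = normal_gram u b a.
Proof. by rewrite /normal_gram formC [Num.sqrt _ * _]mulrC. Qed.

Lemma edge_angle_gram (R : realType) (K : geometry)
    (v u : 'I_4 -> ambient R K) (i j k l : 'I_4) :
  (forall i, in_space (v i)) -> dual_family v u -> uniq [:: i; j; k; l] ->
  edge_angle v [set i; j]%SET = acos (- normal_gram u k l).
Proof.
move=> sv du un; have := un => /uniq4_neq[ij _ _ _ /andP[_ kl]].
rewrite -(edge_pick (F := normal_gram u) kl); last exact: normal_gramC.
rewrite /edge_angle (edge_complement un) (dihedral_gram sv du) ?mulNr //.
have ije := etrans (is_edge_set2 i j) ij; have kle := etrans (is_edge_set2 k l) kl.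
have [e01 _] := edge_ends ije; have [f01 _] := edge_ends kle.
have /andP[e0 e1] := mem_edge_ends ije; have /andP[f0 f1] := mem_edge_ends kle.
have dis a b : a \in [set i; j]%SET -> b \in [set k; l]%SET -> a != b.
  by rewrite -(edge_complement un) !inE => aE; apply: contraNneq => <-.
by rewrite /= !inE !negb_or e01 f01 !dis.
Qed.

Lemma normal_gram_lt1 (R : realType) (K : geometry)
    (v u : 'I_4 -> ambient R K) (a b : 'I_4) :
  (forall i, in_space (v i)) -> dual_family v u -> a != b ->
  -1 < - normal_gram u a b < 1.
Proof.
move=> sv du ab; have := gram_minor_gt0 sv du ab.
have a0 := gram_diag_gt0 sv du a; have b0 := gram_diag_gt0 sv du b.
rewrite -ltr_norml normrN -(expr_lt1 (ltn0Sn 1)) // real_normK ?num_real //.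
rewrite /normal_gram exprMn exprVn exprMn !sqr_sqrtr ?ltW //.
by rewrite ltr_pdivrMr ?mulr_gt0 // mul1r subr_gt0.
Qed.

(** * Angles as functions of one length *)

Lemma edge_mark_set2 (R : realType) (i j b c : 'I_4) : b != c -> i != j ->
  edge_mark R i j b c = ([set b; c]%SET == [set i; j]%SET)%:R.
Proof.
move=> bc ij; rewrite /edge_mark.
have [/andP[/eqP -> /eqP ->]|h1] := boolP ((b == i) && (c == j)).
  by rewrite eqxx (negPf ij) /= addr0.
have [/andP[/eqP -> /eqP ->]|h2] := boolP ((b == j) && (c == i)).
  by rewrite finset.setUC eqxx add0r.
rewrite addr0; case: eqP => // /setP E; move: (E b) (E c) h1 h2 bc.
rewrite !inE !eqxx ?orbT => /esym/orP[] /eqP -> /esym/orP[] /eqP ->;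
  by rewrite !eqxx.
Qed.

Lemma tetrahedron_length (R : realType) (K : geometry)
    (v : 'I_4 -> ambient R K) (i j : 'I_4) :
  tetrahedron v -> i != j ->
  [/\ length_ok K (edge_length v [set i; j]%SET),
      length_pairing K (edge_length v [set i; j]%SET) = pairing (v i) (v j)
    & length_slope K (edge_length v [set i; j]%SET) ^+ 2
      = form (direction (v i) (v j)) (direction (v i) (v j))].
Proof.
move=> [sv nd] ij; have [u du] := dual_family_exists nd.
rewrite edge_length_set2 //; apply: edge_lengthP => //.
exact: (direction_norm_gt0 sv du).
Qed.

(** Realizing the lengths in which x_ij is replaced by t amounts to shifting one
    pairing. *)
Lemma realizes_vary (R : realType) (K : geometry)
    (v w : 'I_4 -> ambient R K) (i j : 'I_4) (t : R) :
  tetrahedron v -> tetrahedron w -> i != j -> length_ok K t ->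
  let f := [set i; j]%SET in
  realizes (vary (edge_length v) f t) w <->
  (forall b c, pairing (w b) (w c) = pairing (v b) (v c)
     + (length_pairing K t - length_pairing K (edge_length v f))
       * edge_mark R i j b c).
Proof.
move=> tv tw ij t_ok f; have [sv _] := tv; have [sw _] := tw.
have [_ lf _] := tetrahedron_length tv ij.
split=> [[_ wx] b c|pE].
  have [->|bc] := eqVneq b c.
    rewrite (pairing_diag (sv c)) (pairing_diag (sw c)) /edge_mark.
    have [->|_] := eqVneq c i; last by rewrite andbF /=; ring.
    by rewrite (negPf ij) /=; ring.
  have [_ <- _] := tetrahedron_length tw bc; have [_ <- _] := tetrahedron_length tv bc.
  rewrite wx ?is_edge_set2 // /vary edge_mark_set2 // -/f.
  by case: eqP => [->|_] /=; ring.
split=> // e /edge_ends[]; move: (end0 e) (end1 e) => b c bc ->.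
rewrite edge_length_set2 //; apply: dist_of_pairing.
  rewrite /vary; case: eqP => // _.
  by have [] := tetrahedron_length tv bc.
rewrite pE edge_mark_set2 // /vary -/f.
have [_ <- _] := tetrahedron_length tv bc.
by case: eqP => [->|_] /=; ring.
Qed.

(** Both perturbed_det and perturbed_gram have this form in e. *)
Lemma is_derive_quadratic (R : realType) (e : R -> R) (t de A p q : R) :
  e t = 0 -> is_derive t 1 e de ->
  is_derive t 1 (fun s => A + e s * p + e s ^+ 2 * q) (de * p).
Proof.
move=> et d_e.
have d_e2 : is_derive t 1 (fun s => e s ^+ 2) 0.
  by apply: is_derive_eq; rewrite et !scale0r addr0.
have dk (k : R) : is_derive t 1 (fun=> k) 0 := is_derive_cst k t 1.
have d1 := is_deriveD (is_deriveD (dk A) (is_deriveM d_e (dk p)))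
  (is_deriveM d_e2 (dk q)).
apply: is_derive_eq d1 _; rewrite /GRing.scale /=; ring.
Qed.

Lemma perturbed_detE (R : realType) (H : 'I_4 -> 'I_4 -> R) i j e :
  perturbed_det H i j e
  = 1 + e * (2 * H i j) + e ^+ 2 * (H i j ^+ 2 - H i i * H j j).
Proof. rewrite /perturbed_det; ring. Qed.

Lemma perturbed_gramE (R : realType) (H : 'I_4 -> 'I_4 -> R) i j a b e :
  perturbed_gram H i j a b e = H a b
    + e * (2 * H i j * H a b - (H j b * H a i + H i b * H a j))
    + e ^+ 2 * ((H i j ^+ 2 - H i i * H j j) * H a b
        - (H i j * H j b - H j j * H i b) * H a i
        - (H i j * H i b - H i i * H j b) * H a j).
Proof. rewrite /perturbed_gram /perturbed_det; ring. Qed.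

Lemma is_derive_acos_ratio (R : realType) (A B C : R -> R) (t a b c : R) :
  is_derive t 1 A a -> is_derive t 1 B b -> is_derive t 1 C c ->
  0 < A t -> 0 < C t -> -1 < - (B t / (Num.sqrt (A t) * Num.sqrt (C t))) < 1 ->
  is_derive t 1 (fun s => acos (- (B s / (Num.sqrt (A s) * Num.sqrt (C s)))))
   ((b - B t * (a / (2 * A t) + c / (2 * C t)))
     / (Num.sqrt (A t) * Num.sqrt (C t)
        * sin (acos (- (B t / (Num.sqrt (A t) * Num.sqrt (C t))))))).
Proof.
move=> dA dB dC A0 C0 q1.
have dsA : is_derive t 1 (fun s => Num.sqrt (A s)) ((2 * Num.sqrt (A t))^-1 * a).
  exact: (is_derive1_comp (is_derive1_sqrt A0) dA).
have dsC : is_derive t 1 (fun s => Num.sqrt (C s)) ((2 * Num.sqrt (C t))^-1 * c).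
  exact: (is_derive1_comp (is_derive1_sqrt C0) dC).
have a0 : Num.sqrt (A t) != 0 by rewrite gt_eqF // sqrtr_gt0.
have c0 : Num.sqrt (C t) != 0 by rewrite gt_eqF // sqrtr_gt0.
pose r s := Num.sqrt (A s) * Num.sqrt (C s).
have dr : is_derive t 1 r (Num.sqrt (A t) * ((2 * Num.sqrt (C t))^-1 * c)
    + Num.sqrt (C t) * ((2 * Num.sqrt (A t))^-1 * a)) by exact: is_deriveM.
have r0 : r t != 0 by rewrite mulf_neq0.
have drV := is_deriveV r0 dr.
pose g s := - (B s / r s).
have dq : is_derive t 1 g (- (B t *: (- (r t) ^- 2 *:
    (Num.sqrt (A t) * ((2 * Num.sqrt (C t))^-1 * c)
     + Num.sqrt (C t) * ((2 * Num.sqrt (A t))^-1 * a))) + (r t)^-1 *: b)).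
  exact: (is_deriveN (is_deriveM dB drV)).
have dacos : is_derive (g t) 1 acos _ := is_derive1_acos q1.
apply: is_derive_eq (is_derive1_comp dacos dq) _.
rewrite sin_acos; last by case/andP: q1 => /ltW -> /ltW ->.
rewrite -/(r t) -/(g t).
have S0 : Num.sqrt (1 - g t ^+ 2) != 0.
  rewrite gt_eqF // sqrtr_gt0 subr_gt0 -real_normK ?num_real //.
  by rewrite expr_lt1 // ltr_norml.
move: (Num.sqrt (1 - g t ^+ 2)) S0 => S S0.
rewrite /GRing.scale /= /r.
have A2 : A t = Num.sqrt (A t) ^+ 2 by rewrite sqr_sqrtr // ltW.
have C2 : C t = Num.sqrt (C t) ^+ 2 by rewrite sqr_sqrtr // ltW.
rewrite [in 2 * A t]A2 [in 2 * C t]C2.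
move: (Num.sqrt (A t)) (Num.sqrt (C t)) a0 c0 => x y x0 y0.
by field; rewrite x0 y0 S0.
Qed.

Lemma dihedral_ratio_scale (R : realType) (D a b c : R) : 0 < D ->
  D * b / (Num.sqrt (D * a) * Num.sqrt (D * c)) = b / (Num.sqrt a * Num.sqrt c).
Proof.
move=> D0; rewrite !sqrtrM ?ltW // mulrACA -expr2 sqr_sqrtr ?ltW //.
by rewrite -mulf_div divff ?mul1r // gt_eqF.
Qed.

(** By gram_perturbation every realization of the varied lengths has the same
    dual Gram matrix, so the choice of one is harmless, and angles can be
    computed from perturbed_gram because they ignore the factor perturbed_det.
    A realization exists, by moving a vertex, as long as perturbed_det is
    positive; this holds near e = 0, where it equals 1. *)
Lemma angle_along_near (R : realType) (K : geometry)
    (v u : 'I_4 -> ambient R K) (a b c d i j : 'I_4) :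
  tetrahedron v -> dual_family v u -> uniq [:: a; b; c; d] -> i != j ->
  let x := edge_length v in
  let f := [set i; j]%SET in
  let G a b t := perturbed_gram (fun a b => form (u a) (u b)) i j a b
    (length_pairing K t - length_pairing K (x f)) in
  \forall t \near x f, angle_along K [set a; b]%SET f x t
    = acos (- (G c d t / (Num.sqrt (G c c t) * Num.sqrt (G d d t)))).
Proof.
move=> tv du un ij x f G; have [sv nd] := tv.
set H := fun a b => form (u a) (u b) in G *.
pose e t := length_pairing K t - length_pairing K (x f).
have [f_ok _ _] := tetrahedron_length tv ij.
have det_near : \forall t \near x f, 0 < perturbed_det H i j (e t).
  have de : is_derive (x f) 1 e (- length_slope K (x f)).
    have := is_derive_length_pairing K (x f) => dl.
    by apply: is_derive_eq; rewrite subr0.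
  have e0 : e (x f) = 0 by rewrite /e subrr.
  have [/derivable1_diffP/differentiable_continuous dc _] :=
    is_derive_quadratic 1 (2 * H i j) (H i j ^+ 2 - H i i * H j j) e0 de.
  have lim0 : 0 < 1 + e (x f) * (2 * H i j)
      + e (x f) ^+ 2 * (H i j ^+ 2 - H i i * H j j).
    by rewrite e0 mul0r expr0n mul0r !addr0 ltr01.
  near=> t; rewrite perturbed_detE; near: t; exact: (cvgr_gt _ dc _ lim0).
near=> t.
have t_ok : length_ok K t by near: t; apply: length_ok_near.
have det_gt0 : 0 < perturbed_det H i j (e t) by near: t.
rewrite /angle_along /angle_of_lengths.
set w := xget _ _.
(* The chosen realization w is a genuine one since the moved tetrahedron exists. *)
have [tw pw] : tetrahedron w /\ forall b c, pairing (w b) (w c)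
    = pairing (v b) (v c) + e t * edge_mark R i j b c.
  suff wx : realizes (vary x f t) w.
    by have tw := wx.1; split=> //; apply/(realizes_vary tv tw ij t_ok).
  have [v' tv' pv'] := move_vertex sv du ij det_gt0.
  suff : [set v0 : 'I_4 -> ambient R K | realizes (vary x f t) v0]%classic w by [].
  apply: xgetPex.
  by exists v'; apply/(realizes_vary tv tv' ij t_ok).
have [sw ndw] := tw; have [u' du'] := dual_family_exists ndw.
rewrite (edge_angle_gram sw du' un); congr acos; congr (- _).
rewrite /normal_gram -(dihedral_ratio_scale _ _ _ det_gt0).
by rewrite !(gram_perturbation du du' pw).
Unshelve. all: by end_near. Qed.

(** The derivative of h_cd with respect to the pairing of v_i and v_j is minus
    sqrt (H_ii H_jj) times this; recall that - h_cd is a cosine. *)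
Definition angle_variation (R : realType) (h : 'I_4 -> 'I_4 -> R)
    (c d i j : 'I_4) : R :=
  h c i * h d j + h c j * h d i - h c d * (h c i * h c j + h d i * h d j).

Lemma normal_gram_diag (R : realType) (K : geometry)
    (v u : 'I_4 -> ambient R K) (a : 'I_4) :
  (forall i, in_space (v i)) -> dual_family v u -> normal_gram u a a = 1.
Proof.
move=> sv du; have a0 := gram_diag_gt0 sv du a.
by rewrite /normal_gram -expr2 sqr_sqrtr ?ltW // divff // gt_eqF.
Qed.

Lemma gram_normal (R : realType) (K : geometry)
    (v u : 'I_4 -> ambient R K) (a b : 'I_4) :
  (forall i, in_space (v i)) -> dual_family v u ->
  form (u a) (u b) = Num.sqrt (form (u a) (u a)) * Num.sqrt (form (u b) (u b))
                     * normal_gram u a b.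
Proof.
move=> sv du; rewrite mulrC divfK // mulf_neq0 // gt_eqF // sqrtr_gt0;
  exact: (gram_diag_gt0 sv du).
Qed.

(** Rewrites the derivative of the angle in terms of the normalized matrix h.
    The terms with 2 H_ij come from the common factor perturbed_det and cancel,
    as they must. *)
Lemma angle_variation_gram (R : realType) (H h : 'I_4 -> 'I_4 -> R)
    (y : 'I_4 -> R) (s S : R) (c d i j : 'I_4) :
  (forall p, y p != 0) -> S != 0 ->
  (forall p q, H p q = y p * y q * h p q) ->
  (forall p, h p p = 1) -> (forall p q, h p q = h q p) ->
  let dH p q := - s * (2 * H i j * H p q - (H j q * H p i + H i q * H p j)) in
  (dH c d - H c d * (dH c c / (2 * H c c) + dH d d / (2 * H d d)))
    / (y c * y d * S)
  = s * (y i * y j) * angle_variation h c d i j / S.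
Proof.
move=> y0 S0 HE h1 hC /=; rewrite /angle_variation !HE !h1.
rewrite (hC j d) (hC i d) (hC j c) (hC i c).
move: (h _ _) (h _ _) (h _ _) (h _ _) (h _ _) (h _ _) => h' *.
by field; rewrite S0 !y0.
Qed.

Lemma is_derive_angle_along (R : realType) (K : geometry)
    (v u : 'I_4 -> ambient R K) (a b c d i j : 'I_4) :
  tetrahedron v -> dual_family v u -> uniq [:: a; b; c; d] -> i != j ->
  let x := edge_length v in
  let f := [set i; j]%SET in
  is_derive (x f) 1 (angle_along K [set a; b]%SET f x)
    (length_slope K (x f)
     * (Num.sqrt (form (u i) (u i)) * Num.sqrt (form (u j) (u j)))
     * angle_variation (normal_gram u) c d i j
     / sin (edge_angle v [set a; b]%SET)).
Proof.
move=> tv du un ij x f; have [sv nd] := tv.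
have := angle_along_near tv du un ij; rewrite /= -/f -/x => near_angle.
set H := fun a b => form (u a) (u b) in near_angle.
pose e t := length_pairing K t - length_pairing K (x f).
have de : is_derive (x f) 1 e (- length_slope K (x f)).
  have := is_derive_length_pairing K (x f) => dl.
  by apply: is_derive_eq; rewrite subr0.
have e0 : e (x f) = 0 by rewrite /e subrr.
pose G p q t := perturbed_gram H i j p q (e t).
have dG p q : is_derive (x f) 1 (G p q) (- length_slope K (x f)
    * (2 * H i j * H p q - (H j q * H p i + H i q * H p j))).
  have := is_derive_quadratic (H p q)
    (2 * H i j * H p q - (H j q * H p i + H i q * H p j))
    ((H i j ^+ 2 - H i i * H j j) * H p q
        - (H i j * H j q - H j j * H i q) * H p i
        - (H i j * H i q - H i i * H j q) * H p j) e0 de.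
  rewrite [G p q](_ : _ = fun s => H p q
    + e s * (2 * H i j * H p q - (H j q * H p i + H i q * H p j))
    + e s ^+ 2 * ((H i j ^+ 2 - H i i * H j j) * H p q
        - (H i j * H j q - H j j * H i q) * H p i
        - (H i j * H i q - H i i * H j q) * H p j)) //.
  by apply/funext => t; rewrite /G perturbed_gramE.
have G0 p q : G p q (x f) = H p q.
  by rewrite /G e0 perturbed_gramE mul0r expr0n mul0r !addr0.
have H0 p : 0 < H p p := gram_diag_gt0 sv du p.
have cd : c != d by have [_ _ _ _ /andP[]] := uniq4_neq un.
have := is_derive_acos_ratio (dG c c) (dG c d) (dG d d).
rewrite !G0 -/(normal_gram u c d) => /(_ (H0 c) (H0 d) (normal_gram_lt1 sv du cd)).
rewrite -(edge_angle_gram sv du un) => dacos.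
apply: near_eq_is_derive (is_derive_eq dacos _).
  by near=> t; apply/esym; near: t.
have s0 : sin (edge_angle v [set a; b]%SET) != 0.
  rewrite gt_eqF // (edge_angle_gram sv du un).
  have /andP[h1 h2] := normal_gram_lt1 sv du cd.
  by rewrite sin_gt0_pi // acos_gt0 ?acos_ltpi // ?h1 ?h2 ltW.
have y0 p : Num.sqrt (H p p) != 0 by rewrite gt_eqF // sqrtr_gt0.
apply: (angle_variation_gram (h := normal_gram u) _ (y := fun p => Num.sqrt (H p p))) => //.
- by move=> p q; apply: gram_normal.
- by move=> p; apply: normal_gram_diag.
- exact: normal_gramC.
Unshelve. all: by end_near. Qed.

(** * The identities *)

(** All that the identities need. The factor is Q = sqrt (H_00 H_11 H_22 H_33 / D)
    with D from the sine law: the derivative contributes sqrt (H_ii H_jj), and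
    the slope at x_ij contributes sqrt (H_kk H_ll) sin a_ij / sqrt D, whose sine
    cancels against the one in the definition of P. *)
Lemma Pcoef_gram (R : realType) (K : geometry) (v : 'I_4 -> ambient R K) :
  tetrahedron v -> exists Q : R, exists h : 'I_4 -> 'I_4 -> R,
  [/\ forall a b, h a b = h b a,
      forall a, h a a = 1,
      forall i j k l, uniq [:: i; j; k; l] ->
        [/\ cos (edge_angle v [set i; j]%SET) = - h k l,
            sin (edge_angle v [set i; j]%SET) ^+ 2 = 1 - h k l ^+ 2
          & 1 - h k l ^+ 2 != 0]
    & forall a b c d i j, uniq [:: a; b; c; d] -> i != j ->
        let e := [set a; b]%SET in
        let f := [set i; j]%SET in
        derivable (angle_along K e f (edge_length v)) (edge_length v f) 1
        /\ Pcoef v e f = Q * (angle_variation h c d i j / (1 - h c d ^+ 2))].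
Proof.
move=> tv; have [sv nd] := tv; have [u du] := dual_family_exists nd.
have [D D0 sine] := sine_law sv du.
pose y p : R := Num.sqrt (form (u p) (u p)).
pose h := normal_gram u.
have y0 p : 0 < y p by rewrite sqrtr_gt0 (gram_diag_gt0 sv du).
have angleE i j k l : uniq [:: i; j; k; l] ->
    [/\ cos (edge_angle v [set i; j]%SET) = - h k l,
        sin (edge_angle v [set i; j]%SET) ^+ 2 = 1 - h k l ^+ 2
      & 0 < sin (edge_angle v [set i; j]%SET)].
  move=> un; have kl : k != l by have [_ _ _ _ /andP[]] := uniq4_neq un.
  rewrite (edge_angle_gram sv du un) -/h.
  have /andP[h1 h2] := normal_gram_lt1 sv du kl.
  have cE : cos (acos (- h k l)) = - h k l by rewrite acosK // in_itv /= !ltW.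
  split=> //; first by rewrite sin2cos2 cE sqrrN.
  by rewrite sin_gt0_pi // acos_gt0 ?acos_ltpi // ?h1 ?h2 ltW.
exists ((\prod_p y p) / Num.sqrt D), h; split.
- exact: normal_gramC.
- by move=> a; apply: normal_gram_diag.
- move=> i j k l /angleE[cE sE s0]; split=> //.
  by rewrite -sE expf_neq0 // gt_eqF.
move=> a b c d i j un ij e f.
have der := is_derive_angle_along tv du un ij; split; first by have [] := der.
have [k [l unf]] := uniq4_extend ij.
have [_ se2 se0] := angleE _ _ _ _ un; have [_ sf2 sf0] := angleE _ _ _ _ unf.
have [f_ok _ slope2] := tetrahedron_length tv ij.
have slopeE : length_slope K (edge_length v f)
    = y k * y l * sin (edge_angle v f) / Num.sqrt D.
  apply/eqP; rewrite -(@eqrXn2 _ 2) //; last 2 first.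
  - by rewrite ltW ?length_slope_gt0.
  - by rewrite divr_ge0 ?sqrtr_ge0 // !mulr_ge0 ?ltW.
  have y2 p : form (u p) (u p) = y p ^+ 2.
    by rewrite sqr_sqrtr // ltW // (gram_diag_gt0 sv du).
  rewrite slope2 expr_div_n !exprMn sf2 (sqr_sqrtr (ltW D0)).
  apply/eqP/(mulfI (lt0r_neq0 D0)); rewrite (sine _ _ _ _ unf).
  rewrite (gram_normal k l sv du) -/h -/(y k) -/(y l) !y2.
  by field; apply: lt0r_neq0.
rewrite /Pcoef derive1E; have [_ ->] := der.
have -> : \prod_p y p = y i * y j * y k * y l.
  by rewrite (uniq4_big _ _ _ unf) !big_cons big_nil /= mulr1 !mulrA.
rewrite slopeE -/(y i) -/(y j) -/h -se2 -/e -/f.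
have sD0 : Num.sqrt D != 0 by rewrite gt_eqF // sqrtr_gt0.
have cancel_sines (se sf sD yi yj yk yl T : R) : se != 0 -> sf != 0 -> sD != 0 ->
    (se * sf)^-1 * (yk * yl * sf / sD * (yi * yj) * T / se)
    = yi * yj * yk * yl / sD * (T / se ^+ 2).
  by move=> se_n0 sf_n0 sD_n0; field; rewrite se_n0 sf_n0 sD_n0.
exact: cancel_sines (lt0r_neq0 se0) (lt0r_neq0 sf0) sD0.
Qed.

Theorem theorem2p1 (R : realType) (K : geometry)
    (v : 'I_4 -> ambient R K) (hv : tetrahedron v) :
  let x := edge_length v in
  let P (i j r s : 'I_4) : R := Pcoef v [set i; j]%SET [set r; s]%SET in
  let a (r s : 'I_4) : R := edge_angle v [set r; s]%SET in
  let c (r s : 'I_4) : R := cos (a r s) in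
  let w (i j k l : 'I_4) : R :=
    (c i j * c j k * c k i + c i j * c j l * c l i + c i k * c j l + c i l * c j k)
      / sin (a i j) ^+ 2 in
  (forall e f : {set 'I_4}, is_edge e -> is_edge f ->
     derivable (angle_along K e f x) (x f) 1)
  /\ (forall i j r s : 'I_4, i != j -> r != s -> P i j r s = P r s i j)
  /\ (forall i j k l : 'I_4, uniq [:: i; j; k; l] ->
        P i j k l = P i k j l /\ P i k j l = P i l j k)
  /\ (forall i j k l : 'I_4, uniq [:: i; j; k; l] ->
        P i j i k = - P i j k l * cos (a j k))
  /\ (forall i j k l : 'I_4, uniq [:: i; j; k; l] ->
        P i j i j = P i j k l * w i j k l)
  /\ (forall e f : {set 'I_4}, is_edge e -> is_edge f -> e != f ->
        Pcoef v e f = Pcoef v (~: e)%SET (~: f)%SET).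
Proof.
move=> x P a c w; have [Q [h [hC h1 angleE PE]]] := Pcoef_gram hv.
have opp i j k l : uniq [:: i; j; k; l] -> P i j k l = Q.
  move=> un; have kl : k != l by have [_ _ _ _ /andP[]] := uniq4_neq un.
  rewrite /P; have [_ ->] := PE _ _ _ _ _ _ un kl.
  have [_ _ nz] := angleE _ _ _ _ un.
  rewrite /angle_variation (hC l k) !h1.
  by field.
have adj i j k l : uniq [:: i; j; k; l] -> P i j i k = Q * h i l.
  move=> un; have ik : i != k by have [] := uniq4_neq un.
  rewrite /P; have [_ ->] := PE _ _ _ _ _ _ un ik.
  have [_ _ nz] := angleE _ _ _ _ un.
  rewrite /angle_variation (hC l k) (hC l i) !h1.
  by field.
have cE i j k l : uniq [:: i; j; k; l] -> c i j = - h k l.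
  by move=> /angleE[].
split=> [e f e2 f2|].
  have [i [j E]] : exists i j, i != j /\ f = [set i; j]%SET.
    by have [] := edge_ends f2; exists (end0 f), (end1 f).
  have [ij ->] := E; have [+ ->] := edge_ends e2.
  move: (end0 e) (end1 e) => p q pq; have [r [s un]] := uniq4_extend pq.
  by have [] := PE _ _ _ _ _ _ un ij.
split=> [i j r s|].
  rewrite /P -!is_edge_set2 => ij rs.
  case: (edge_pairP ij rs) => [//|p q k l un|p q k l un].
    rewrite -/(P p q k l) -/(P k l p q).
    by rewrite (opp _ _ _ _ un) (opp _ _ _ _ (uniq4_swap un)).
  rewrite -/(P p q p k) -/(P p k p q) (adj _ _ _ _ un).
  by rewrite (adj _ _ _ _ (uniq4_swap23 un)).
split=> [i j k l un|].
  rewrite (opp _ _ _ _ un) (opp _ _ _ _ (uniq4_swap23 un)).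
  by rewrite (opp _ _ _ _ (uniq4_swap23 (uniq4_swap34 un))).
split=> [i j k l un|].
  rewrite (adj _ _ _ _ un) (opp _ _ _ _ un) -/(c j k).
  rewrite (cE j k i l); first by ring.
  by apply/uniq4_swap23/uniq4_swap12.
split=> [i j k l un|e f e2 f2].
  have ij : i != j by have [] := uniq4_neq un.
  rewrite (opp _ _ _ _ un) /w /P; have [_ ->] := PE _ _ _ _ _ _ un ij.
  have [_ -> _] := angleE _ _ _ _ un.
  congr (_ * (_ / _)); rewrite /angle_variation.
  have unC p q : c p q = c q p by rewrite /c /a finset.setUC.
  rewrite (unC k i) (unC l i) (cE _ _ _ _ un).
  rewrite (cE _ _ _ _ (uniq4_swap23 un)).
  rewrite (cE j k i l); last by apply/uniq4_swap23/uniq4_swap12.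
  rewrite (cE j l i k); last by apply/uniq4_swap23/uniq4_swap12/uniq4_swap34.
  rewrite (cE i l j k); last by apply/uniq4_swap23/uniq4_swap34.
  rewrite (hC l j) (hC k i) (hC k j) (hC l i).
  ring.
case: (edge_pairP e2 f2) => [g gg|i j k l un _|i j k l un _].
  by case/eqP: gg.
  rewrite (edge_complement un) (edge_complement (uniq4_swap un)).
  rewrite -/(P i j k l) -/(P k l i j).
  by rewrite (opp _ _ _ _ un) (opp _ _ _ _ (uniq4_swap un)).
rewrite (edge_complement un) (edge_complement (uniq4_swap23 un)).
rewrite [in RHS](finset.setUC [set k]%SET) [in RHS](finset.setUC [set j]%SET).
rewrite -/(P i j i k) -/(P l k l j) (adj _ _ _ _ un).
by rewrite (adj _ _ _ _ (uniq4_swap34 (uniq4_swap12 (uniq4_swap un)))) hC.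
Qed.
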